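(* For every rank 3 w-colored graph $\mathcal G$, $$\mathfrak T_{\mathcal G}(x,y,z,s,w,q,t)=\sum_{A\Subset\mathcal G}(x-1)^{r(\mathcal G)-r(A)}(y-1)^{n(A)}z^{5k(A)-[3(V-E(A))+2(F_{\rm int}(A)-B_{\rm int}(A)-B_{\rm ext}(A))]}\,s^{C_\partial(A)}w^{F_\partial(A)}q^{E_\partial(A)}t^{f(A)}$$ (where $V=V(\mathcal G)=V(A)$ and the other quantities are defined in the context) is a polynomial in $x,y,z,s,w,q,t$.
   Context: All objects are finite. **Stranded vertices and edges.** A rank $D$ stranded pre-vertex ($D\ge 1$) is a set $S$ of $2n$ elements (vertex points) with two partitions of $S$: one into non-empty parts of size at most $D$ (pre-edges), one into pairs (chords). For $n=0$ it is called a trivial circle (of any rank). Its vertex graph has the pre-edges as vertices and one edge per chord, joining the pre-edges containing the two points of the chord. It is connected if $S$ cannot be split into two non-empty parts such that no pre-edge and no chord meets both; a stranded vertex is a connected stranded pre-vertex. Its coordination is its number of pre-edges. A stranded edge of rank $d\ge1$ is a set of $2d$ elements (edge points) with a partition into two sets of size $d$ (ends) and a partition into $d$ pairs (strands), each strand containing one point from each end. **HESG.** A rank $D$ half-edged stranded graph (HESG) consists of a set $V$ of disjoint rank $D$ stranded vertices, a set $E\sqcup \mathfrak f^0$ of disjoint stranded edges of rank at most $D$, and a map $\phi$ from edge points to vertex points, defined on both ends of every element of $E$ and on exactly one end of each element of $\mathfrak f^0$, which is injective, maps each of these ends bijectively onto some pre-edge, and is surjective onto all vertex points. Elements of $\mathfrak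 f^0$ are stranded half-edges (sHEs); the points of the unattached end of an sHE are its external points. Collapsing stranded vertices to points and stranded edges to lines gives the underlying graph; connectedness is understood in it. Trivial circles count as stranded vertices and as connected components. **Faces.** Identifying each attached edge point with its image under $\phi$, the chords and strands form a disjoint union of cycles and paths (between external points). Each cycle is a closed face, each path an open face; moreover each trivial circle has, by convention, one closed face. **Cut and c-subgraphs.** Cutting a stranded edge $e$ means deleting it and attaching an sHE of the same rank (and color) at each of the two pre-edges where $e$ was attached. A spanning c-subgraph $A\Subset\mathcal G$ is obtained by cutting all edges in some subset of $E$ (all vertices and sHEs are kept). **Contraction.** Let $e$ be a stranded edge, $s$ its set of strands and $c$ the set of chords these strands meet. The components of $s\cup c$ are cycles (inner faces of $e$), say $p$ of them, and paths. $\mathcal G/e$ is obtained by replacing $e$ and its end vertices (or end vertex, for a loop) by $p$ trivial circles and a new pre-vertex $v'$, whose pre-edges are those of the end vertices not attached to $e$ (with all other edges and sHEs still attached), and whose chords are the chords of the end vertices not in $c$ together with one new chord for each path of $s\cup c$, joining the ends of that path. If $v'$ is disconnected it is split into its connected parts; if all strands of $e$ lie in inner faces there is no $v'$. **Colors.** A rank $D$ half-edged colored tensor graph (HEcTG) is a rank $D$ HESG in which every stranded vertex has coordination $D+1$, every pre-edge has $D$ points, every vertex graph is $K_{D+1}$, all edges and sHEs have rank $D$, the underlying graph is bipartite, and the edges and sHEs are colored by $\{0,\dots,D\}$ so that no two meeting at a vertex have the same color. A pre-edge has the color of the edge or sHE attached to it; a vertex point has color $(i,j)$ with $i$ the color of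 its pre-edge and $j$ that of the pre-edge containing the other end of its chord; the chord then has color pair $\{i,j\}$. In an edge of color $i$ the two end points of each strand are required to have the same color pair $(i,j)$, and the strand gets the color pair $\{i,j\}$ (similarly for sHEs). A rank $D$ w-colored graph is a rank $D$ HESG obtained from a rank $D$ HEcTG by zero or more successive stranded edge contractions. It inherits colors of edges, sHEs, pre-edges and color pairs of points, strands, chords (a new chord gets the common pair of the path it replaces) and faces (a trivial circle gets the pair of its inner face). **Bubbles (rank 3).** For three distinct colors $a,b,c$, keep only the points whose color $(i,j)$ has $i,j\in\{a,b,c\}$, with the chords and strands on them. The connected components (two points being connected when joined by a chord or a strand, or in the same pre-edge, or in the same end of an edge or sHE) are the 3-bubbles of colors $abc$. A bubble is open if it contains external points of sHEs, otherwise closed. Trivial circles are not counted as bubbles. **Boundary (rank 3).** The boundary graph has one vertex per sHE and one edge per open face, joining the sHEs containing the two end points of the face. A vertex has the color of its sHE, an edge the color pair of its open face. Its faces are, for each set $\{a,b,c\}$ of three distinct colors, the cycles which are the connected components of the subgraph formed by the edges with color pair contained in $\{a,b,c\}$. **Quantities.** $k$: number of connected components; $V,E,f$: numbers of stranded vertices, stranded edges, sHEs; $F_{\rm int}$: number of closed faces; $B_{\rm int},B_{\rm ext}$: numbers of closed and open 3-bubbles; $C_\partial,E_\partial,F_\partial$: numbers of connected components, edges and faces of the boundary graph; $r=V-k$; $n=E+k-V$. *)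

(* Defs.v *)
From mathcomp Require Import all_boot all_algebra fraction mpoly.

Set Implicit Arguments.
Unset Strict Implicit.
Unset Printing Implicit Defensive.

Import GRing.Theory.

Section Blocks.

Variable T : finType.
Implicit Types (P : {set {set T}}) (A S : {set T}).

Definition same_block P : rel T :=
  fun x y => [exists B in P, (x \in B) && (y \in B)].

Definition comps (r : rel T) A : {set {set T}} :=
  equivalence_partition
    (connect [rel x y | [&& x \in A, y \in A & r x y || r y x]]) A.

Definition stranded_prevertex (D : nat) S (pre ch : {set {set T}}) : bool :=
  [&& partition pre S, [forall B in pre, #|B| <= D],
      partition ch S & [forall c in ch, #|c| == 2]].

Definition connected_prevertex S (pre ch : {set {set T}}) : bool :=
  ~~ [exists A : {set T},
        [&& A \subset S, A != set0, S :\: A != set0 &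
            [forall B in pre :|: ch, (B \subset A) || [disjoint B & A]]]].

Definition stranded_edge (d : nat) S (en st : {set {set T}}) : bool :=
  [&& 0 < d, #|S| == 2 * d,
      [&& partition en S, #|en| == 2 & [forall B in en, #|B| == d]],
      partition st S, #|st| == d &
      [forall s in st, (#|s| == 2) && [forall B in en, #|s :&: B| == 1]]].

End Blocks.

(* Points are taken in ambient finite types [vp] (vertex points) and [ep]
   (edge points).  A non-trivial stranded vertex, an edge or a stranded
   half-edge is given by its set of points; its pre-edges, chords, ends or
   strands are the members of [preedges], ..., [strands] included in that set.
   Trivial circles have no points, hence are only counted.
   The values of [phi] outside the edge points of the graph are irrelevant. *)
Record stranded_graph (vp ep : finType) := StrandedGraph {
  vertices : {set {set vp}};
  circles : nat;
  preedges : {set {set vp}};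
  chords : {set {set vp}};
  edges : {set {set ep}};
  shes : {set {set ep}};
  ends : {set {set ep}};
  strands : {set {set ep}};
  phi : ep -> option vp
}.

Section Hesg.

Variables vp ep : finType.
Implicit Types (G : stranded_graph vp ep) (X e : {set ep}).

Definition vpoints G : {set vp} := cover (vertices G).
Definition epoints G : {set ep} := cover (edges G :|: shes G).

(* the image of X under phi *)
Definition att G X : {set vp} := [set x | [exists q in X, phi G q == Some x]].

Definition end_vertices G X : {set {set vp}} :=
  [set v in vertices G | ~~ [disjoint v & att G X]].

Record is_hesg (D : nat) G : Prop := IsHesg {
  hesg_rank : 0 < D;
  hesg_vertices_nontrivial : set0 \notin vertices G;
  hesg_vertices_disjoint : trivIset (vertices G);
  hesg_vertices : forall v, v \in vertices G ->
    stranded_prevertex D v (preedges G ::&: v) (chords G ::&: v) /\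
    connected_prevertex v (preedges G ::&: v) (chords G ::&: v);
  hesg_blocks_vertex : forall B, B \in preedges G :|: chords G ->
    exists2 v, v \in vertices G & B \subset v;
  hesg_edges_shes : [disjoint edges G & shes G];
  hesg_edges_disjoint : trivIset (edges G :|: shes G);
  hesg_edges : forall X, X \in edges G :|: shes G ->
    exists2 d, d <= D & stranded_edge d X (ends G ::&: X) (strands G ::&: X);
  hesg_blocks_edge : forall B, B \in ends G :|: strands G ->
    exists2 X, X \in edges G :|: shes G & B \subset X;
  hesg_phi_edges : forall e, e \in edges G ->
    forall q, q \in e -> isSome (phi G q);
  hesg_phi_shes : forall h, h \in shes G ->
    exists2 B, B \in ends G ::&: h &
      forall q, q \in h -> isSome (phi G q) = (q \in B);
  hesg_phi_inj : forall q q' x, q \in epoints G -> q' \in epoints G ->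
    phi G q = Some x -> phi G q' = Some x -> q = q';
  hesg_phi_ends : forall B, B \in ends G ->
    (forall q, q \in B -> isSome (phi G q)) -> att G B \in preedges G;
  hesg_phi_onto : att G (epoints G) = vpoints G
}.

(* Components of s :|: c, the attached edge points being identified with their
   images: the points of att G e meet a strand and a chord, the other points
   of cover c only a chord.  Thus a component is a cycle iff it is included in
   att G e, and otherwise its points outside att G e are the two ends of a
   path. *)
Section Contraction.

Variables (G : stranded_graph vp ep) (e : {set ep}).

Definition met_chords : {set {set vp}} :=
  [set ch in chords G | ~~ [disjoint ch & att G e]].

Definition edge_comps : {set {set vp}} :=
  comps (same_block (met_chords :|: [set att G s | s in strands G ::&: e]))
        (cover met_chords).

Definition inner_faces : {set {set vp}} :=
  [set K in edge_comps | K \subset att G e].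

Definition new_chords : {set {set vp}} :=
  [set K :\: att G e | K in edge_comps :\: inner_faces].

Definition contract_chords : {set {set vp}} :=
  (chords G :\: met_chords) :|: new_chords.

Definition contract_preedges : {set {set vp}} :=
  [set P in preedges G | [disjoint P & att G e]].

Definition contract : stranded_graph vp ep := {|
  vertices := (vertices G :\: end_vertices G e) :|:
    comps (same_block (contract_preedges :|: contract_chords))
          (cover (end_vertices G e) :\: att G e);
  circles := circles G + #|inner_faces|;
  preedges := contract_preedges;
  chords := contract_chords;
  edges := edges G :\ e;
  shes := shes G;
  ends := ends G :\: (ends G ::&: e);
  strands := strands G :\: (strands G ::&: e);
  phi := phi G
|}.

End Contraction.

(* Cutting the edges of C.  An end B of a cut edge becomes the attached end of
   a new half-edge, whose external points are the copies [inr x] of the vertex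
   points x of att G B, joined by a strand to the edge point mapped to x. *)
Section Cut.

Variables (G : stranded_graph vp ep) (C : {set {set ep}}).

Definition cut_ends : {set {set ep}} :=
  [set B in ends G | [exists e in C, B \subset e]].

Definition cut_strands : {set {set ep}} :=
  [set s in strands G | [exists e in C, s \subset e]].

Definition lift_e (A : {set ep}) : {set ep + vp} := [set inl q | q in A].
Definition lift_v (A : {set vp}) : {set ep + vp} := [set inr x | x in A].

Definition cut : stranded_graph vp (ep + vp)%type := {|
  vertices := vertices G;
  circles := circles G;
  preedges := preedges G;
  chords := chords G;
  edges := [set lift_e X | X in edges G :\: C];
  shes := [set lift_e X | X in shes G] :|:
          [set lift_e B :|: lift_v (att G B) | B in cut_ends];
  ends := [set lift_e B | B in ends G] :|:
          [set lift_v (att G B) | B in cut_ends];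
  strands := [set lift_e s | s in strands G :\: cut_strands] :|:
    [set [set inl u.1; inr u.2] | u in [set u : ep * vp |
        (u.1 \in cover C) && (phi G u.1 == Some u.2)]];
  phi := fun z => if z is inl q then phi G q else None
|}.

End Cut.

Definition underlying_adj G : rel {set vp} := fun v v' =>
  [exists e in edges G, (v \in end_vertices G e) && (v' \in end_vertices G e)].

Definition nV G : nat := #|vertices G| + circles G.
Definition nE G : nat := #|edges G|.
Definition nsHE G : nat := #|shes G|.
Definition nk G : nat := #|comps (underlying_adj G) (vertices G)| + circles G.

Definition rk G : int := (nV G)%:Z - (nk G)%:Z.
Definition nullity G : int := (nE G)%:Z + (nk G)%:Z - (nV G)%:Z.

Definition points G : {set vp + ep} :=
  [set inl x | x in vpoints G] :|: [set inr q | q in epoints G].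

Definition external G : {set vp + ep} :=
  [set inr q | q in [set q in epoints G | ~~ isSome (phi G q)]].

(* The identification of an attached edge point with its image under phi is
   rendered by joining the two points. *)
Definition face_adj G : rel (vp + ep) := fun z z' =>
  match z, z' with
  | inl x, inl y => same_block (chords G) x y
  | inr q, inr q' => same_block (strands G) q q'
  | inl x, inr q => phi G q == Some x
  | inr q, inl x => phi G q == Some x
  end.

Definition faces G : {set {set vp + ep}} := comps (face_adj G) (points G).

Definition closed_faces G : {set {set vp + ep}} :=
  [set F in faces G | [disjoint F & external G]].
Definition open_faces G : {set {set vp + ep}} :=
  [set F in faces G | ~~ [disjoint F & external G]].

Definition nFint G : nat := #|closed_faces G| + circles G.

(* F has an end point in the half-edge h *)
Definition face_at G (F : {set vp + ep}) (h : {set ep}) : bool :=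
  [exists q in h, (inr q \in external G) && (inr q \in F)].

Definition boundary_adj G (Fs : {set {set vp + ep}}) : rel {set ep} :=
  fun h h' => [exists F in Fs, face_at G F h && face_at G F h'].

Definition nEbd G : nat := #|open_faces G|.
Definition nCbd G : nat := #|comps (boundary_adj G (open_faces G)) (shes G)|.

End Hesg.

(* The color (i, j) of an edge point has as first component the color i of the
   edge or half-edge containing it. *)
Record colored_graph (D : nat) (vp ep : finType) := ColoredGraph {
  graph_of :> stranded_graph vp ep;
  vcol : vp -> 'I_D.+1 * 'I_D.+1;
  ecol : ep -> 'I_D.+1 * 'I_D.+1
}.

Section Colored.

Variables (D : nat) (vp ep : finType).
Implicit Type G : colored_graph D vp ep.

Record is_hectg G : Prop := IsHectg {
  hectg_hesg : is_hesg D G;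
  hectg_no_circle : circles G = 0;
  hectg_coordination : forall v, v \in vertices G ->
    #|preedges G ::&: v| = D.+1;
  hectg_preedges : forall P, P \in preedges G -> #|P| = D;
  hectg_no_loop_chord : forall P c, P \in preedges G -> c \in chords G ->
    ~~ (c \subset P);
  hectg_complete : forall v P P', v \in vertices G ->
    P \in preedges G ::&: v -> P' \in preedges G ::&: v -> P != P' ->
    #|[set c in chords G | ~~ [disjoint c & P] & ~~ [disjoint c & P']]| = 1;
  hectg_edges_rank : forall X, X \in edges G :|: shes G ->
    stranded_edge D X (ends G ::&: X) (strands G ::&: X);
  hectg_bipartite : exists U : {set {set vp}}, forall e, e \in edges G ->
    end_vertices G e :&: U != set0 /\ end_vertices G e :\: U != set0;
  hectg_edge_color : forall X q q', X \in edges G :|: shes G ->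
    q \in X -> q' \in X -> (ecol G q).1 = (ecol G q').1;
  hectg_proper : forall X X' q q',
    X \in edges G :|: shes G -> X' \in edges G :|: shes G -> X != X' ->
    ~~ [disjoint end_vertices G X & end_vertices G X'] ->
    q \in X -> q' \in X' -> (ecol G q).1 != (ecol G q').1;
  hectg_vcol : forall q q' x x', q \in epoints G -> q' \in epoints G ->
    phi G q = Some x -> phi G q' = Some x' -> x != x' ->
    [set x; x'] \in chords G -> vcol G x = ((ecol G q).1, (ecol G q').1);
  hectg_ecol : forall q x, q \in epoints G ->
    phi G q = Some x -> ecol G q = vcol G x;
  hectg_strands : forall s q q', s \in strands G ->
    q \in s -> q' \in s -> ecol G q = ecol G q'
}.

Definition ccontract G (e : {set ep}) : colored_graph D vp ep :=
  {| graph_of := contract G e; vcol := vcol G; ecol := ecol G |}.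

Definition ccut G (C : {set {set ep}}) : colored_graph D vp (ep + vp)%type :=
  {| graph_of := cut G C; vcol := vcol G;
     ecol := fun z => match z with inl q => ecol G q | inr x => vcol G x end |}.

Inductive w_colored : colored_graph D vp ep -> Prop :=
| w_colored_hectg G : is_hectg G -> w_colored G
| w_colored_contract G e :
    w_colored G -> e \in edges G -> w_colored (ccontract G e).

Definition pcol G (z : vp + ep) : 'I_D.+1 * 'I_D.+1 :=
  match z with inl x => vcol G x | inr q => ecol G q end.

Definition in_colors G (abc : {set 'I_D.+1}) : {set vp + ep} :=
  [set z | ((pcol G z).1 \in abc) && ((pcol G z).2 \in abc)].

Definition bubble_adj G : rel (vp + ep) := fun z z' =>
  face_adj G z z' ||
  match z, z' with
  | inl x, inl y => same_block (preedges G) x y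
  | inr q, inr q' => same_block (ends G) q q'
  | _, _ => false
  end.

Definition bubbles G (abc : {set 'I_D.+1}) : {set {set vp + ep}} :=
  comps (bubble_adj G) (points G :&: in_colors G abc).

Definition nBint G : nat :=
  \sum_(abc : {set 'I_D.+1} | #|abc| == 3)
    #|[set b in bubbles G abc | [disjoint b & external G]]|.
Definition nBext G : nat :=
  \sum_(abc : {set 'I_D.+1} | #|abc| == 3)
    #|[set b in bubbles G abc | ~~ [disjoint b & external G]]|.

(* All points of a face have the same unordered color pair. *)
Definition open_faces_in G (abc : {set 'I_D.+1}) : {set {set vp + ep}} :=
  [set F in open_faces G | F \subset in_colors G abc].

Definition nFbd G : nat :=
  \sum_(abc : {set 'I_D.+1} | #|abc| == 3)
    #|comps (boundary_adj G (open_faces_in G abc))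
        [set h in shes G | [exists F in open_faces_in G abc, face_at G F h]]|.

End Colored.

Local Open Scope ring_scope.

Definition T_poly (vp ep : finType) (G : colored_graph 3 vp ep)
    (K : fieldType) (x y z s w q t : K) : K :=
  \sum_(C : {set {set ep}} | C \subset edges G)
    let A := ccut G C in
    (x - 1) ^ (rk G - rk A) *
    (y - 1) ^ (nullity A) *
    z ^ (5 * (nk A)%:Z - (3 * ((nV A)%:Z - (nE A)%:Z) +
           2 * ((nFint A)%:Z - (nBint A)%:Z - (nBext A)%:Z))) *
    s ^+ nCbd A * w ^+ nFbd A * q ^+ nEbd A * t ^+ nsHE A.

Definition indet (i : 'I_7) : {fraction {mpoly int[7]}} := tofrac 'X_i.

(* Main.v *)
Require Import Defs.
From mathcomp Require Import all_boot all_algebra fraction mpoly.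
From mathcomp Require Import zify.

(* All exponents are nonnegative.  For x and y this is elementary graph theory.
   For z, fix three colors abc: the points of these colors form a ribbon graph
   whose components are the bubbles, so Euler's inequality bounds the number of
   vertices and closed faces meeting abc by #edges + 2 #bubbles.  An edge has
   points in three triples, a closed face in two, and a vertex in at least three,
   so that summing over abc gives 3 V + 2 F <= 3 E + 2 B when trivial circles
   are left out; each of these contributes 5 - 3 - 2 = 0 to the exponent.
   Euler's inequality is proved by linear algebra: if A, B, C are the subspaces
   of functions over F_2 on the points that are invariant under chords,
   pre-edges and strands, then A :&: B + A :&: C and A + B :&: C are orthogonal.
   Only a few properties of G enter, and these survive contraction; cutting is
   then treated directly. *)

Set Implicit Arguments.
Unset Strict Implicit.
Unset Printing Implicit Defensive.

Import GRing.Theory.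

(** * Isotropic subspaces and Euler's inequality *)

(** On the set X of flags, chords together with pre-edges generate the vertices, chords with strands
    the faces, pre-edges with strands the edges, and all three the components. The dimension count
    gives V + F + E <= #|X| / 2 + 2 B: the term #|X| / 2 counts the pairs of one matching, and the 2
    appears because each of the two orthogonal sums has the triple intersection as its overlap. In
    characteristic 2, functions constant on blocks of even size are orthogonal to each other, so no
    orientation of the ribbons has to be chosen. Half-edges are an obstacle, since their strands
    leave attached points unmatched. The remedy is to let a pre-edge attached to a half-edge,
    original or created by a cut, be a block of the third partition. It then adds 1 both to E and to
    #|X| / 2 and cancels, whereas an uncut edge has two pre-edges and leaves 1 on the right.
    Contraction is the other obstacle, since it destroys the complete vertex graphs. What survives
    is that a pre-edge of color i has exactly one point (i, j) for each j other than i, and this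
    suffices to count points in color triples. *)

Section Isotropic.

Variables (F : fieldType) (n : nat).
Implicit Types A B C : 'M[F]_n.

Lemma orthogonal_sym m1 m2 (A : 'M[F]_(m1, n)) (B : 'M[F]_(m2, n)) :
  (A <= kermx B^T)%MS = (B <= kermx A^T)%MS.
Proof.
apply/sub_kermxP/sub_kermxP => h; apply: trmx_inj;
  by rewrite trmx_mul trmxK h trmx0.
Qed.

Lemma orthogonal_sub m1 m2 m3 m4 (A : 'M[F]_(m1, n)) (B : 'M[F]_(m2, n))
    (A' : 'M[F]_(m3, n)) (B' : 'M[F]_(m4, n)) :
  (A <= A')%MS -> (B <= B')%MS -> (A' <= kermx B'^T)%MS ->
  (A <= kermx B^T)%MS.
Proof.
move=> sA sB h; rewrite orthogonal_sym; apply: submx_trans sB _.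
by rewrite orthogonal_sym; apply: submx_trans sA h.
Qed.

(* [A :&: B + A :&: C] is orthogonal to [A + B :&: C]. *)
Lemma isotropic_triple_rank A B C :
    (A :&: B <= kermx A^T)%MS -> (A :&: C <= kermx A^T)%MS ->
    (B <= kermx B^T)%MS -> (C <= kermx C^T)%MS ->
  \rank (A :&: B)%MS + \rank (A :&: C)%MS + \rank (B :&: C)%MS + \rank A
    <= n + 2 * \rank (A :&: B :&: C)%MS.
Proof.
move=> hAB hAC hB hC.
have sU : (A :&: B + A :&: C <= kermx (A + B :&: C)%MS^T)%MS.
  rewrite orthogonal_sym addsmx_sub.
  have h1 : (A <= kermx (A :&: B + A :&: C)%MS^T)%MS.
    by rewrite orthogonal_sym addsmx_sub hAB.
  rewrite h1 /= orthogonal_sym addsmx_sub.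
  apply/andP; split.
    by apply: orthogonal_sub hB; rewrite ?capmxSr ?capmxSl.
  by apply: orthogonal_sub hC; rewrite capmxSr.
(* Orthogonal spaces have ranks adding up to at most [n]. Each of the two sums overlaps in
   [A :&: B :&: C], which accounts for the factor 2. *)
have := mulmx0_rank_max (sub_kermxP sU); rewrite mxrank_tr.
have := mxrank_sum_cap (A :&: B)%MS (A :&: C)%MS.
have := mxrank_sum_cap A (B :&: C)%MS.
have -> : \rank ((A :&: B) :&: (A :&: C))%MS = \rank (A :&: B :&: C)%MS.
  apply/eqmx_rank/andP; split.
    rewrite sub_capmx capmxSl /=; apply: submx_trans (capmxSr _ _) _.
    exact: capmxSr.
  rewrite sub_capmx capmxSl sub_capmx capmxSr andbT.
  by apply: submx_trans (capmxSl _ _) _; apply: capmxSl.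
have -> : \rank (A :&: (B :&: C))%MS = \rank (A :&: B :&: C)%MS.
  by apply: eqmx_rank; rewrite capmxA !submx_refl.
lia.
Qed.

End Isotropic.

(** * Functions on a finite type as row vectors, and bounds for the rank of function spaces *)

Section Functions.

Variables (F : fieldType) (T : finType).
Local Notation n := #|T|.

Definition fun_of_row (v : 'rV[F]_n) (x : T) : F := v 0%R (enum_rank x).
Definition row_of_fun (u : T -> F) : 'rV[F]_n := (\row_i u (enum_val i))%R.

Lemma row_of_funK u : fun_of_row (row_of_fun u) =1 u.
Proof. by move=> x; rewrite /fun_of_row mxE enum_rankK. Qed.

Lemma fun_of_row_eq0 v : (forall x, fun_of_row v x = 0%R) -> v = 0%R.
Proof.
by move=> h; apply/rowP => i; rewrite mxE -(h (enum_val i)) /fun_of_row enum_valK.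
Qed.

Lemma sum_enum_val (f : 'I_n -> F) :
  (\sum_i f i = \sum_x f (enum_rank x))%R.
Proof. by rewrite (reindex (@enum_rank T)) //=; apply: onW_bij; apply: enum_rank_bij. Qed.

Lemma dot_row (v w : 'rV[F]_n) :
  ((v *m w^T) 0 0 = \sum_x fun_of_row v x * fun_of_row w x)%R.
Proof. by rewrite mxE sum_enum_val; apply: eq_bigr => x _; rewrite mxE. Qed.

Lemma orthogonal_dot (A B : 'M[F]_n) :
  (forall v w : 'rV[F]_n, (v <= A)%MS -> (w <= B)%MS ->
     (\sum_x fun_of_row v x * fun_of_row w x = 0)%R) ->
  (A <= kermx B^T)%MS.
Proof.
move=> h; apply/sub_kermxP/matrixP => i j.
have := h (row i A) (row j B) (row_sub _ _) (row_sub _ _).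
rewrite -dot_row => h0; rewrite [RHS]mxE -[RHS]h0 !mxE.
by apply: eq_bigr => k _; rewrite !mxE.
Qed.

Section Annihilator.

Variables (I : finType) (D : {set I}) (L : I -> T -> F).

Definition annihilator : 'M[F]_n :=
  kermx (\matrix_(i < n, j < #|D|) L (enum_val j) (enum_val i))%R.

Lemma annihilatorP (v : 'rV[F]_n) :
  reflect (forall i, i \in D -> (\sum_x fun_of_row v x * L i x = 0)%R)
          (v <= annihilator)%MS.
Proof.
apply: (iffP sub_kermxP) => [h i iD|h].
  have /rowP/(_ (enum_rank_in iD i)) := h.
  rewrite !mxE sum_enum_val => h'; rewrite -[RHS]h'.
  by apply: eq_bigr => x _; rewrite mxE enum_rankK enum_rankK_in.
apply/rowP => j; rewrite !mxE sum_enum_val -[RHS](h (enum_val j)) ?enum_valP //.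
by apply: eq_bigr => x _; rewrite mxE enum_rankK.
Qed.

Lemma rank_annihilator : n <= \rank annihilator + #|D|.
Proof.
rewrite mxrank_ker.
have := rank_leq_col (\matrix_(i < n, j < #|D|) L (enum_val j) (enum_val i))%R.
lia.
Qed.

End Annihilator.

(** Restriction to [R] is injective on [W]: the space [Z] of functions vanishing on [R] has
    codimension at most [#|R|] and meets [W] trivially. *)
Lemma rank_le_of_vanishing (W : 'M[F]_n) (R : {set T}) :
  (forall v : 'rV[F]_n, (v <= W)%MS ->
     (forall x, x \in R -> fun_of_row v x = 0%R) -> v = 0%R) ->
  \rank W <= #|R|.
Proof.
move=> h; pose Z := annihilator R (fun x y => (x == y)%:R)%R.
have W0 : (W :&: Z)%MS = 0%R.
  apply/row_matrixP => i; rewrite row0; apply: h.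
    by apply: submx_trans (row_sub _ _) (capmxSl _ _).
  move=> x xR; have : (row i (W :&: Z)%MS <= Z)%MS.
    by apply: submx_trans (row_sub _ _) (capmxSr _ _).
  move/annihilatorP/(_ x xR).
  rewrite (bigD1 x) //= eqxx mulr1 big1 ?addr0 // => y /negPf.
  by rewrite eq_sym => ->; rewrite mulr0.
have := mxrank_sum_cap W Z; rewrite W0 mxrank0.
have := rank_annihilator R (fun x y => (x == y)%:R : F)%R.
have := rank_leq_col (W + Z)%MS; rewrite -/Z; lia.
Qed.

(** A function in [W] is determined by its values on one representative of each class of [c] in [X];
    [g] chooses the representatives and [R] collects them. *)
Lemma rank_le_classes (K : finType) (c : T -> K) (X : {set T}) (W : 'M[F]_n) :
  (forall v : 'rV[F]_n, (v <= W)%MS ->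
     (forall x, x \notin X -> fun_of_row v x = 0%R) /\
     {in X &, forall x y, c x = c y -> fun_of_row v x = fun_of_row v y}) ->
  \rank W <= #|c @: X|.
Proof.
move=> h; pose g k := [pick y in X | c y == k].
pose R := [set x | Some x \in g @: (c @: X)].
apply: leq_trans (_ : #|R| <= _); last first.
  rewrite -(card_imset _ Some_inj); apply: leq_trans (leq_imset_card g _).
  by apply/subset_leq_card/subsetP => _ /imsetP[x + ->]; rewrite inE.
apply: rank_le_of_vanishing => v /h[v0 vc] vR; apply: fun_of_row_eq0 => x.
have [xX|/v0//] := boolP (x \in X).
have /imset_f : c x \in c @: X by apply: imset_f.
move=> /(_ _ g); rewrite {1}/g; case: pickP => [y /andP[yX /eqP cyx] gR|/(_ x)].
  by rewrite (vc x y) //; apply: vR; rewrite inE.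
by rewrite /= xX eqxx.
Qed.

Definition indicator (B : {set T}) : 'rV[F]_n := row_of_fun (fun x => (x \in B)%:R)%R.

(** Indicators of disjoint non-empty sets are linearly independent. The matrix [N] evaluates at one
    chosen point per block, so it is a right inverse of the matrix [M] of indicators. *)
Lemma rank_ge_blocks (Q : {set {set T}}) (W : 'M[F]_n) :
  trivIset Q -> set0 \notin Q ->
  (forall B, B \in Q -> (indicator B <= W)%MS) ->
  #|Q| <= \rank W.
Proof.
move=> tI Q0 h.
have pickQ (i : 'I_#|Q|) : {x | x \in enum_val i}.
  apply/sigW/set0Pn; apply: contraNneq Q0 => <-; exact: enum_valP.
pose M := (\matrix_(i < #|Q|) indicator (enum_val i))%R.
have sM : (M <= W)%MS by apply/row_subP => i; rewrite rowK h ?enum_valP.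
apply: leq_trans (mxrankS sM).
pose N : 'M[F]_(n, #|Q|) :=
  (\matrix_(k < n, j < #|Q|) (enum_val k == sval (pickQ j))%:R)%R.
apply: (@mulmx1_min_rank _ _ _ _ M 1%:M%R N); rewrite mul1mx.
apply/matrixP => i j; rewrite !mxE sum_enum_val (bigD1 (sval (pickQ j))) //=.
rewrite big1 => [|x /negPf xj]; last by rewrite !mxE !enum_rankK xj mulr0.
rewrite addr0 !mxE !enum_rankK eqxx mulr1; congr (_%:R)%R; congr nat_of_bool.
apply/idP/eqP => [h'|->]; last exact: (svalP (pickQ j)).
apply: enum_val_inj; apply/eqP; apply: contraTT (svalP (pickQ j)) => ne.
have /trivIsetP/(_ _ _ (enum_valP i) (enum_valP j) ne) := tI.
by move/disjointFr => ->.
Qed.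

End Functions.

(** * Functions over F_2 invariant under partitions; Euler's inequality *)

Section TriplePartition.

Variable T : finType.
Local Notation n := #|T|.
Implicit Types (P Q : {set {set T}}) (X B S : {set T}).

Definition constant_on (u : T -> 'F_2) P : Prop :=
  forall B, B \in P -> {in B &, forall x y, u x = u y}.

Definition invariant_functions P X : 'M['F_2]_n :=
  capmx
    (annihilator [set p : T * T | same_block P p.1 p.2]
      (fun p x => (x == p.1)%:R - (x == p.2)%:R)%R)
    (annihilator (~: X) (fun y x => (x == y)%:R)%R).

Lemma sum_pred1 (F : pzSemiRingType) (u : T -> F) y :
  (\sum_x u x * (x == y)%:R = u y)%R.
Proof.
rewrite (bigD1 y) //= eqxx mulr1 big1 ?addr0 // => x /negPf ->.
by rewrite mulr0.
Qed.

Lemma invariant_functionsP P X (v : 'rV['F_2]_n) :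
  reflect (constant_on (fun_of_row v) P /\
           forall x, x \notin X -> fun_of_row v x = 0%R)
          (v <= invariant_functions P X)%MS.
Proof.
rewrite sub_capmx; apply: (iffP andP) => -[h1 h2]; split.
- move=> B BP x y xB yB; move/annihilatorP/(_ (x, y)): h1.
  rewrite inE /= => /(_ _)/eqP; rewrite (eq_bigr _ (fun _ _ => mulrBr _ _ _)).
  rewrite sumrB !sum_pred1 subr_eq0 => h; apply/eqP/h.
  by apply/existsP; exists B; rewrite BP xB yB.
- by move=> x xX; move/annihilatorP/(_ x): h2; rewrite inE sum_pred1; apply.
- apply/annihilatorP => -[x y]; rewrite inE /= => /existsP[B].
  case/and3P => BP xB yB; rewrite (eq_bigr _ (fun _ _ => mulrBr _ _ _)).
  by rewrite sumrB !sum_pred1 (h1 B BP x y xB yB) subrr.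
- by apply/annihilatorP => x; rewrite inE sum_pred1; apply: h2.
Qed.

Lemma natr_F2 (m : nat) : ((m%:R : 'F_2) == 0)%R = ~~ odd m.
Proof. by rewrite -(dvdn_pcharf (pchar_Fp (isT : prime 2))) dvdn2. Qed.

(** The product [u * w] is constant on a block, so the block contributes an even multiple of an
    element of F_2. Off [X] the factor [w] vanishes. *)
Lemma isotropic_invariant P X (u w : T -> 'F_2) :
  partition P X -> (forall B, B \in P -> ~~ odd #|B|) ->
  constant_on u P -> constant_on w P ->
  (forall x, x \notin X -> w x = 0%R) ->
  (\sum_x u x * w x = 0)%R.
Proof.
move=> /and3P[/eqP cP tP P0] evP uP wP w0.
rewrite (bigID (mem X)) /= [X in (_ + X)%R]big1 ?addr0; last first.
  by move=> x /w0 ->; rewrite mulr0.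
rewrite -cP big_trivIset //= big1 // => B BP.
have /set0Pn[x xB] : B != set0 by apply: contraNneq P0 => <-.
rewrite (eq_bigr (fun=> u x * w x)%R) => [|y yB]; last first.
  by rewrite (uP B BP y x) // (wP B BP y x).
rewrite sumr_const -mulr_natr; apply/eqP; rewrite mulf_eq0 natr_F2.
by rewrite evP ?orbT.
Qed.

(** For blocks of size two, sum zero over F_2 means constant. This encoding spends a single equation
    per block, so the codimension is at most [#|P|]. Values outside the blocks stay free, unlike in
    [invariant_functions], so that the dimension of the ambient space cancels in Euler's
    inequality. *)
Definition even_functions P : 'M['F_2]_n :=
  annihilator P (fun B x => (x \in B)%:R)%R.

Lemma sum_mem (u : T -> 'F_2) B : (\sum_x u x * (x \in B)%:R = \sum_(x in B) u x)%R.
Proof.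
rewrite [RHS]big_mkcond; apply: eq_bigr => x _.
by case: (x \in B); rewrite ?mulr1 ?mulr0.
Qed.

Lemma even_functions_constant P (v : 'rV['F_2]_n) :
  (forall B, B \in P -> #|B| <= 2) -> (v <= even_functions P)%MS ->
  constant_on (fun_of_row v) P.
Proof.
move=> P2 /annihilatorP h B BP x y xB yB; have := h B BP; rewrite sum_mem.
have [-> //|nxy] := eqVneq x y.
have -> : B = [set x; y].
  apply/esym/eqP; rewrite eqEcard subUset !sub1set xB yB cards2 nxy.
  exact: P2.
rewrite big_setU1 ?inE //= big_set1 => /eqP; rewrite addr_eq0 => /eqP ->.
by rewrite oppr_pchar2 // pchar_Fp.
Qed.

Lemma constant_even_functions P (v : 'rV['F_2]_n) :
  (forall B, B \in P -> ~~ odd #|B|) -> constant_on (fun_of_row v) P ->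
  (v <= even_functions P)%MS.
Proof.
move=> P2 h; apply/annihilatorP => B BP; rewrite sum_mem.
have [->|/set0Pn[x xB]] := eqVneq B set0; first by rewrite big_set0.
rewrite (eq_bigr (fun=> fun_of_row v x)) => [|y yB]; last exact: (h B BP).
rewrite sumr_const -mulr_natr; apply/eqP; rewrite mulf_eq0 natr_F2.
by rewrite P2 ?orbT.
Qed.

Definition saturated P Q : Prop :=
  forall S B, S \in Q -> B \in P -> (B \subset S) || [disjoint B & S].

Lemma saturated_constant P Q S : saturated P Q -> S \in Q ->
  constant_on (fun x => (x \in S)%:R)%R P.
Proof.
move=> sQ SQ B BP x y xB yB; have /orP[/subsetP h|h] := sQ S B SQ BP.
  by rewrite !h.
by rewrite !(disjointFr h).
Qed.

Lemma constant_row_of_fun u P :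
  constant_on u P -> constant_on (fun_of_row (row_of_fun u)) P.
Proof. by move=> h B BP x y xB yB; rewrite !row_of_funK; apply: (h B). Qed.

Lemma indicator_invariant P Q X S : saturated P Q -> S \in Q -> S \subset X ->
  (indicator 'F_2 S <= invariant_functions P X)%MS.
Proof.
move=> sQ SQ SX; apply/invariant_functionsP; split.
  exact/constant_row_of_fun/(saturated_constant sQ).
move=> x xX; rewrite row_of_funK; case: (boolP (x \in S)) => // xS.
by rewrite (subsetP SX) in xX.
Qed.

Lemma indicator_even P Q S : saturated P Q -> S \in Q ->
  (forall B, B \in P -> ~~ odd #|B|) ->
  (indicator 'F_2 S <= even_functions P)%MS.
Proof.
move=> sQ SQ evP; apply: constant_even_functions => //.
exact/constant_row_of_fun/(saturated_constant sQ).
Qed.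

(* Euler's inequality V - E + F <= 2 B for a possibly non-orientable ribbon
   graph with half-edges: X is the set of flags and the three partitions are
   the adjacencies of flags. *)
Lemma triple_partition_bound X PA PB PC QAB QAC QBC (K : finType) (c : T -> K) :
  partition PA X -> partition PB X -> partition PC X ->
  (forall B, B \in PA -> #|B| = 2) ->
  (forall B, B \in PB :|: PC -> ~~ odd #|B|) ->
  [/\ trivIset QAB, set0 \notin QAB, saturated PA QAB, saturated PB QAB &
      forall S, S \in QAB -> S \subset X] ->
  [/\ trivIset QAC, set0 \notin QAC, saturated PA QAC, saturated PC QAC &
      forall S, S \in QAC -> S \subset X] ->
  [/\ trivIset QBC, set0 \notin QBC, saturated PB QBC, saturated PC QBC &
      forall S, S \in QBC -> S \subset X] ->
  (forall u : T -> 'F_2, (forall x, x \notin X -> u x = 0%R) ->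
     constant_on u PA -> constant_on u PB -> constant_on u PC ->
     {in X &, forall x y, c x = c y -> u x = u y}) ->
  #|QAB| + #|QAC| + #|QBC| <= #|PA| + 2 * #|c @: X|.
Proof.
move=> pA pB pC A2 evBC [tAB nAB sAB1 sAB2 AB] [tAC nAC sAC1 sAC2 AC]
  [tBC nBC sBC1 sBC2 BC] hc.
have A2' B : B \in PA -> #|B| <= 2 by move/A2->.
have evA B : B \in PA -> ~~ odd #|B| by move/A2->.
have evB B : B \in PB -> ~~ odd #|B| by move=> h; apply: evBC; rewrite inE h.
have evC B : B \in PC -> ~~ odd #|B|.
  by move=> h; apply: evBC; rewrite inE h orbT.
pose A := even_functions PA.
pose B := invariant_functions PB X; pose C := invariant_functions PC X.
(* The space [A] itself is free off [X], hence not isotropic in general; intersecting with functions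
   supported on [X] makes it orthogonal to [A]. *)
have oA P : (A :&: invariant_functions P X <= kermx A^T)%MS.
  rewrite orthogonal_sym; apply: orthogonal_dot => v w /even_functions_constant hv.
  rewrite sub_capmx => /andP[/even_functions_constant hw].
  case/invariant_functionsP => _ w0.
  exact: (isotropic_invariant pA evA (hv A2') (hw A2') w0).
have oI P : partition P X -> (forall B, B \in P -> ~~ odd #|B|) ->
    (invariant_functions P X <= kermx (invariant_functions P X)^T)%MS.
  move=> pP evP; apply: orthogonal_dot => v w.
  case/invariant_functionsP => hv _ /invariant_functionsP[hw w0].
  exact: (isotropic_invariant pP evP hv hw w0).
have := isotropic_triple_rank (oA PB) (oA PC) (oI _ pB evB) (oI _ pC evC).
have : #|QAB| <= \rank (A :&: B)%MS.
  apply: rank_ge_blocks => // S SQ; rewrite sub_capmx (indicator_even sAB1) //=.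
  by rewrite (indicator_invariant sAB2) // AB.
have : #|QAC| <= \rank (A :&: C)%MS.
  apply: rank_ge_blocks => // S SQ; rewrite sub_capmx (indicator_even sAC1) //=.
  by rewrite (indicator_invariant sAC2) // AC.
have : #|QBC| <= \rank (B :&: C)%MS.
  apply: rank_ge_blocks => // S SQ; rewrite sub_capmx.
  by rewrite (indicator_invariant sBC1) ?(indicator_invariant sBC2) // BC.
have : \rank (A :&: B :&: C)%MS <= #|c @: X|.
  apply: rank_le_classes => v; rewrite 2!sub_capmx => /andP[/andP[hA]].
  move=> /invariant_functionsP[hB v0] /invariant_functionsP[hC _].
  by split=> //; apply: hc => //; apply: even_functions_constant.
(* Since [A] has codimension at most [#|PA|], moving its rank to the right replaces the ambient
   dimension by [#|PA|]. *)
have := rank_annihilator PA (fun (B : {set T}) x => (x \in B)%:R : 'F_2)%R.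
rewrite -/(even_functions PA) -/A -/B -/C; lia.
Qed.

(** Each edge of a graph imposes one equation on functions on its vertices, so the space of
    solutions supported on [X] has dimension at least [#|X| - #|E|]. A solution is constant on
    components, which are the classes of [c] in the applications. *)
Lemma forest_bound X (E : {set {set T}}) (K : finType) (c : T -> K) :
  (forall B, B \in E -> #|B| <= 2) ->
  (forall u : T -> 'F_2, constant_on u E ->
     {in X &, forall x y, c x = c y -> u x = u y}) ->
  #|X| <= #|c @: X| + #|E|.
Proof.
move=> E2 hc.
pose Z : 'M['F_2]_n := annihilator (~: X) (fun y x => (x == y)%:R)%R.
pose W := (even_functions E :&: Z)%MS.
have : \rank W <= #|c @: X|.
  apply: rank_le_classes => v; rewrite sub_capmx => /andP[h1 h2]; split.
    by move=> x xX; move/annihilatorP/(_ x): h2; rewrite inE sum_pred1; apply.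
  by apply: hc; apply: even_functions_constant.
have := rank_annihilator E (fun (B : {set T}) x => (x \in B)%:R : 'F_2)%R.
have := rank_annihilator (~: X) (fun y x => (x == y)%:R : 'F_2)%R.
have := mxrank_sum_cap (even_functions E) Z.
rewrite -/W -/Z -/(even_functions E) => h1 h2 h3.
have := rank_leq_col (even_functions E + Z)%MS.
have := cardsC X; lia.
Qed.

End TriplePartition.

(** * Components of matchings *)

Section Partitions.

Variable T : finType.
Implicit Types (P Q : {set {set T}}) (A B K : {set T}) (r : rel T).

Lemma partitionI P A :
  set0 \notin P -> (forall B, B \in P -> B \subset A) ->
  (forall x, x \in A -> exists2 B, B \in P & x \in B) ->
  (forall B B' x, B \in P -> B' \in P -> x \in B -> x \in B' -> B = B') ->
  partition P A.
Proof.
move=> P0 PA AP PI; apply/and3P; split=> //.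
  rewrite eqEsubset; apply/andP; split; first exact/bigcupsP.
  by apply/subsetP => x /AP[B BP xB]; apply/bigcupP; exists B.
apply/trivIsetP => B B' BP BP' nBB'; rewrite -setI_eq0.
apply: contraR nBB' => /set0Pn[x /setIP[xB xB']].
by apply/eqP; apply: (PI B B' x).
Qed.

Lemma trivIset_inj P B B' x : trivIset P ->
  B \in P -> B' \in P -> x \in B -> x \in B' -> B = B'.
Proof.
move=> /trivIsetP tP BP BP' xB xB'; apply/eqP; apply: contraTT xB' => nBB'.
by rewrite (disjointFr (tP _ _ BP BP' nBB')).
Qed.

Lemma partition_inj P A B B' x : partition P A ->
  B \in P -> B' \in P -> x \in B -> x \in B' -> B = B'.
Proof. by case/and3P=> _ tP _; apply: trivIset_inj. Qed.

Lemma partition_sub P A B : partition P A -> B \in P -> B \subset A.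
Proof. by case/and3P=> /eqP <- _ _ BP; apply: bigcup_sup BP. Qed.

Lemma partition_mem P A x : partition P A -> x \in A ->
  exists2 B, B \in P & x \in B.
Proof. by case/and3P=> /eqP <- _ _ /bigcupP[B]; exists B. Qed.

Lemma partition_nonempty P A B : partition P A -> B \in P ->
  exists x, x \in B.
Proof.
by case/and3P=> _ _ P0 BP; apply/set0Pn; apply: contraNneq P0 => <-.
Qed.

Lemma partition_subset_refine P A K : partition P A ->
  (forall B, B \in P -> (B \subset K) || [disjoint B & K]) ->
  partition (P ::&: K) (A :&: K).
Proof.
move=> pP sK; apply: partitionI.
- by rewrite inE; case/and3P: pP => _ _ /negPf ->.
- move=> B; rewrite inE => /andP[BP BK]; rewrite subsetI BK andbT.
  exact: partition_sub BP.
- move=> x /setIP[/(partition_mem pP)[B BP xB] xK]; exists B => //.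
  rewrite inE BP /=; have /orP[//|d] := sK B BP.
  by rewrite (disjointFr d xB) in xK.
- by move=> B B' x; rewrite !inE => /andP[BP _] /andP[BP' _]; apply: partition_inj pP _ _.
Qed.

Lemma symmetric_restriction r A :
  ssrbool.symmetric [rel x y | [&& x \in A, y \in A & r x y || r y x]].
Proof. by move=> x y /=; rewrite orbC andbCA. Qed.

Lemma comps_equivalence r A : {in A & &,
  equivalence_rel (connect [rel x y | [&& x \in A, y \in A & r x y || r y x]])}.
Proof.
move=> x y z _ _ _; split; first exact: connect0.
by move=> /(same_connect (sym_connect_sym (@symmetric_restriction r A)))/(_ z).
Qed.

Lemma comps_partition r A : partition (comps r A) A.
Proof. exact/equivalence_partitionP/comps_equivalence. Qed.

Lemma mem_pblock_comps r A x y : x \in A -> y \in A ->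
  (y \in pblock (comps r A) x) =
  connect [rel x y | [&& x \in A, y \in A & r x y || r y x]] x y.
Proof.
move=> xA yA; apply: pblock_equivalence_partition => //.
exact: comps_equivalence.
Qed.

Lemma comps_connect r A K x y : K \in comps r A -> x \in K ->
  connect [rel x y | [&& x \in A, y \in A & r x y || r y x]] x y = (y \in K).
Proof.
move=> Kc xK; have pc := comps_partition r A.
have xA := subsetP (partition_sub pc Kc) x xK.
have KE : pblock (comps r A) x = K by apply: def_pblock xK => //; case/and3P: pc.
apply/idP/idP => [h|yK].
  rewrite -KE mem_pblock_comps //.
  case/connectP: h => p pp ->; elim: p x xA {xK KE} pp => //= z p IH x xA.
  by case/andP=> /and3P[_ zA _]; apply: IH.
by rewrite -mem_pblock_comps ?KE // (subsetP (partition_sub pc Kc)).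
Qed.

Lemma comps_step r A K x y : K \in comps r A -> x \in K -> y \in A ->
  r x y || r y x -> y \in K.
Proof.
move=> Kc xK yA rxy; rewrite -(comps_connect _ Kc xK); apply: connect1 => /=.
by rewrite rxy yA (subsetP (partition_sub (comps_partition r A) Kc)).
Qed.

Lemma comps_const r A (V : eqType) (f : T -> V) K x y :
  {in A &, forall x y, r x y -> f x = f y} ->
  K \in comps r A -> x \in K -> y \in K -> f x = f y.
Proof.
move=> fr Kc xK; rewrite -(comps_connect _ Kc xK) => /connectP[p + ->].
elim: p x {xK} => //= z p IH x /andP[/and3P[xA zA rxz]] /IH <-.
by case/orP: rxz => /fr ->.
Qed.

Lemma same_blockP P x y :
  reflect (exists2 B, B \in P & (x \in B) && (y \in B)) (same_block P x y).
Proof.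
apply: (iffP existsP) => [[B /andP[? ?]]|[B ? ?]]; exists B => //.
exact/andP.
Qed.

Lemma saturated_comps P A : (forall B, B \in P -> B \subset A) ->
  saturated P (comps (same_block P) A).
Proof.
move=> PA K B Kc BP; have [/pred0P h|/pred0Pn[x /andP[xB xK]]] := boolP [disjoint B & K].
  by rewrite orbT.
rewrite orbF; apply/subsetP => y yB; apply: (comps_step Kc xK).
  exact: subsetP (PA B BP) y yB.
by apply/orP; left; apply/same_blockP; exists B => //; apply/andP.
Qed.

Lemma card_saturated P A K : partition P A ->
  (forall B, B \in P -> #|B| = 2) ->
  (forall B, B \in P -> (B \subset K) || [disjoint B & K]) ->
  #|A :&: K| = #|P ::&: K| * 2.
Proof.
move=> pP P2 sK; apply: card_uniform_partition (partition_subset_refine pP sK).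
by move=> B; rewrite inE => /andP[/P2].
Qed.

(* K is a cycle or a path: being connected, it has at most one more point than
   it has matched pairs. *)
Lemma card_matching_component P Q A A' K :
  partition P A -> partition Q A' -> A' \subset A ->
  (forall B, B \in P :|: Q -> #|B| = 2) ->
  K \in comps (same_block (P :|: Q)) A -> ~~ (K \subset A') ->
  #|K :\: A'| = 2.
Proof.
move=> pP pQ sA PQ2 Kc nK.
have sat : saturated (P :|: Q) (comps (same_block (P :|: Q)) A).
  apply: saturated_comps => B; rewrite inE => /orP[/(partition_sub pP)//|].
  by move=> /(partition_sub pQ)/subset_trans; apply.
have KA := partition_sub (comps_partition _ _) Kc.
have cP : #|A :&: K| = #|P ::&: K| * 2.
  by apply: card_saturated => // B BP; rewrite ?PQ2 ?(sat K B) // inE BP.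
have cQ : #|A' :&: K| = #|Q ::&: K| * 2.
  by apply: card_saturated => // B BP; rewrite ?PQ2 ?(sat K B) // inE BP orbT.
have : #|K| <= #|(fun _ : T => tt) @: K| + #|(P :|: Q) ::&: K|.
  apply: forest_bound => [B|u hu x y xK yK _].
    by rewrite inE => /andP[/PQ2->].
  (* [u] is controlled only by the blocks inside [K]. Its extension by zero is constant on all
     blocks, because each of them lies in [K] or misses it. *)
  pose f z := if z \in K then u z else 0%R.
  suff: f x = f y by rewrite /f xK yK.
  apply: (comps_const (f := f) _ Kc xK yK) => a b aA bA; rewrite /f.
  case/same_blockP => B BPQ /andP[aB bB].
  have /orP[BK|BK] := sat K B Kc BPQ; last by rewrite !(disjointFr BK).
  rewrite !(subsetP BK) //; apply: (hu B) => //; by rewrite inE BPQ.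
have -> : (P :|: Q) ::&: K = (P ::&: K) :|: (Q ::&: K).
  by apply/setP => B; rewrite !inE andb_orl.
have := (leq_card_setU (P ::&: K) (Q ::&: K)).1.
have := leq_imset_card (fun _ : T => tt) K.
have : #|(fun _ : T => tt) @: K| <= 1.
  by rewrite (leq_trans (max_card _)) // card_unit.
have := cardsID A' K; rewrite (setIC K); move: cP; rewrite (setIidPr KA).
(* With p and q blocks of [P] and [Q] in [K], the forest bound reads 2p <= 1 + p + q, so [K :\: A']
   has 2p - 2q <= 2 points. This number is even and positive. *)
have : 0 < #|K :\: A'| by rewrite card_gt0 setD_eq0.
lia.
Qed.

End Partitions.

(** * Tame graphs *)

Section Tame.

Variables (D : nat) (vp ep : finType).
Implicit Types (G : colored_graph D vp ep) (X e Y : {set ep}).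

Definition color_pair G (x : vp) : {set 'I_D.+1} :=
  [set (vcol G x).1; (vcol G x).2].

(* The part of the structure of a w-colored graph that survives contraction
   and suffices for counting faces and bubbles.  Unlike in a HEcTG, a chord may
   join two points of the same color (i, j). *)
Record tame G : Prop := Tame {
  tame_vertices : partition (vertices G) (vpoints G);
  tame_chords : partition (chords G) (vpoints G);
  tame_preedges : partition (preedges G) (vpoints G);
  tame_blocks_vertex : forall B, B \in preedges G :|: chords G ->
    exists2 v, v \in vertices G & B \subset v;
  tame_chord_card : forall c, c \in chords G -> #|c| = 2;
  tame_chord_color : forall c x y, c \in chords G -> x \in c -> y \in c ->
    color_pair G x = color_pair G y;
  tame_preedge_card : forall P, P \in preedges G -> #|P| = D;
  tame_preedge_color1 : forall P x y, P \in preedges G -> x \in P -> y \in P ->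
    (vcol G x).1 = (vcol G y).1;
  tame_preedge_color2 : forall P x y, P \in preedges G -> x \in P -> y \in P ->
    (vcol G x).2 = (vcol G y).2 -> x = y;
  tame_color_neq : forall x, x \in vpoints G -> (vcol G x).1 != (vcol G x).2;
  tame_edges_shes : [disjoint edges G & shes G];
  tame_edges_disjoint : trivIset (edges G :|: shes G);
  tame_edges : forall X, X \in edges G :|: shes G ->
    stranded_edge D X (ends G ::&: X) (strands G ::&: X);
  tame_blocks_edge : forall B, B \in ends G :|: strands G ->
    exists2 X, X \in edges G :|: shes G & B \subset X;
  tame_phi_edges : forall e, e \in edges G ->
    forall q, q \in e -> isSome (phi G q);
  tame_phi_shes : forall h, h \in shes G ->
    exists2 B, B \in ends G ::&: h &
      forall q, q \in h -> isSome (phi G q) = (q \in B);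
  tame_phi_inj : forall q q' x, q \in epoints G -> q' \in epoints G ->
    phi G q = Some x -> phi G q' = Some x -> q = q';
  tame_phi_ends : forall B, B \in ends G ->
    (forall q, q \in B -> isSome (phi G q)) -> att G B \in preedges G;
  tame_phi_onto : att G (epoints G) = vpoints G;
  tame_ecol : forall q x, q \in epoints G ->
    phi G q = Some x -> ecol G q = vcol G x;
  tame_strands : forall s q q', s \in strands G ->
    q \in s -> q' \in s -> ecol G q = ecol G q';
  tame_edge_color : forall X q q', X \in edges G :|: shes G ->
    q \in X -> q' \in X -> (ecol G q).1 = (ecol G q').1
}.

Lemma attP (G : stranded_graph vp ep) X x :
  reflect (exists2 q, q \in X & phi G q = Some x) (x \in att G X).
Proof.
rewrite inE; apply: (iffP existsP) => [[q /andP[? /eqP ?]]|[q ? ?]];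
  exists q => //; exact/andP/(conj _ (introT eqP _)).
Qed.

Lemma attS (G : stranded_graph vp ep) X Y :
  X \subset Y -> att G X \subset att G Y.
Proof.
move=> XY; apply/subsetP => x /attP[q qX qx]; apply/attP; exists q => //.
exact: subsetP XY q qX.
Qed.

Section TameTheory.

Variable G : colored_graph D vp ep.
Hypothesis tG : tame G.

Lemma mem_epoints X q : X \in edges G :|: shes G -> q \in X -> q \in epoints G.
Proof. by move=> XE qX; apply/bigcupP; exists X. Qed.

Lemma mem_edge e : e \in edges G -> e \in edges G :|: shes G.
Proof. by rewrite inE => ->. Qed.

Lemma mem_she e : e \in shes G -> e \in edges G :|: shes G.
Proof. by rewrite inE orbC => ->. Qed.

Lemma edge_inj X Y q : X \in edges G :|: shes G -> Y \in edges G :|: shes G ->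
  q \in X -> q \in Y -> X = Y.
Proof. exact: trivIset_inj (tame_edges_disjoint tG). Qed.

Lemma att_vpoints X : X \in edges G :|: shes G -> att G X \subset vpoints G.
Proof.
move=> XE; rewrite -(tame_phi_onto tG); apply: attS.
by apply/subsetP => q; apply: mem_epoints.
Qed.

Lemma att_inj X Y x : X \in edges G :|: shes G -> Y \in edges G :|: shes G ->
  x \in att G X -> x \in att G Y -> X = Y.
Proof.
move=> XE YE /attP[q qX qx] /attP[q' qY q'x].
have E : q = q'.
  by apply: (tame_phi_inj tG _ _ qx q'x); [apply: mem_epoints qX|apply: mem_epoints qY].
by apply: edge_inj qX _ => //; rewrite E.
Qed.

Lemma card_att Y : Y \subset epoints G ->
  (forall q, q \in Y -> isSome (phi G q)) -> #|att G Y| = #|Y|.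
Proof.
move=> YE phiY; rewrite -(card_imset _ Some_inj).
rewrite -(card_in_imset (f := phi G) (D := Y)); last first.
  move=> q q' qY q'Y E; have := phiY q qY; case Ex: (phi G q) => [x|] // _.
  apply: (tame_phi_inj tG _ _ Ex); rewrite -?E //; exact: (subsetP YE).
congr #|pred_of_set _|; apply/setP => o; apply/imsetP/imsetP => -[].
  by move=> x /attP[q qY qx] ->; exists q.
move=> q qY ->; have := phiY q qY; case Ex: (phi G q) => [x|] // _.
by exists x => //; apply/attP; exists q.
Qed.

Lemma ends_partition X : X \in edges G :|: shes G -> partition (ends G ::&: X) X.
Proof. by move=> /(tame_edges tG)/and5P[_ _ /and3P[]]. Qed.

Lemma strands_partition X : X \in edges G :|: shes G ->
  partition (strands G ::&: X) X.
Proof. by move=> /(tame_edges tG)/and5P[]. Qed.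

Lemma strand_card s : s \in strands G -> #|s| = 2.
Proof.
move=> sS; have [|X XE sX] := tame_blocks_edge tG (B := s); first by rewrite inE sS orbT.
have /and5P[_ _ _ _ /andP[_]] := tame_edges tG XE.
by move/forall_inP/(_ s); rewrite inE sS sX => /(_ isT)/andP[/eqP].
Qed.

Lemma strand_end X s B : X \in edges G :|: shes G ->
  s \in strands G ::&: X -> B \in ends G ::&: X -> #|s :&: B| = 1.
Proof.
move=> /(tame_edges tG)/and5P[_ _ _ _ /andP[_]].
by move=> /forall_inP h /h/andP[_ /forall_inP h'] /h'/eqP.
Qed.

Lemma att_end_preedge e B : e \in edges G -> B \in ends G -> B \subset e ->
  att G B \in preedges G.
Proof.
move=> eE BE Be; apply: (tame_phi_ends tG) => // q qB.
exact: (tame_phi_edges tG eE) (subsetP Be q qB).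
Qed.

Lemma preedge_att_edge P e x : e \in edges G -> P \in preedges G ->
  x \in P -> x \in att G e ->
  exists2 B, B \in ends G ::&: e & P = att G B.
Proof.
move=> eE PP xP /attP[q qe qx].
have [B] := partition_mem (ends_partition (mem_edge eE)) qe.
rewrite inE => /andP[BE Be] qB; exists B; first by rewrite inE BE.
apply: (partition_inj (tame_preedges tG) PP (att_end_preedge eE BE Be) xP).
by apply/attP; exists q.
Qed.

Lemma preedge_att P e : e \in edges G -> P \in preedges G ->
  (P \subset att G e) || [disjoint P & att G e].
Proof.
move=> eE PP; have [_|] := boolP [disjoint P & att G e]; first by rewrite orbT.
case/pred0Pn => x /andP[xP xe]; rewrite orbF.
have [B] := preedge_att_edge eE PP xP xe.
by rewrite inE => /andP[_ Be] ->; apply: attS.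
Qed.

(** Transporting strands along [phi] turns them into a matching of vertex points, so that chords,
    pre-edges and strands all live on the same type. *)
Lemma att_strands_partition e : e \in edges G ->
  partition [set att G s | s in strands G ::&: e] (att G e).
Proof.
move=> eE; have pS := strands_partition (mem_edge eE).
apply: partitionI.
- apply/imsetP => -[s sS E].
  have [q qs] := partition_nonempty pS sS.
  have qe := subsetP (partition_sub pS sS) q qs.
  have := tame_phi_edges tG eE qe; case Ex: (phi G q) => [x|] // _.
  have : x \in att G s by apply/attP; exists q.
  by rewrite -E inE.
- move=> _ /imsetP[s sS ->]; apply: attS; exact: partition_sub pS sS.
- move=> x /attP[q qe qx]; have [s sS qs] := partition_mem pS qe.
  by exists (att G s); [apply: imset_f|apply/attP; exists q].
- move=> _ _ x /imsetP[s sS ->] /imsetP[s' s'S ->].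
  move=> /attP[q qs qx] /attP[q' qs' q'x].
  have sub s0 q0 : s0 \in strands G ::&: e -> q0 \in s0 -> q0 \in epoints G.
    move=> h0 h1; apply: (mem_epoints (mem_edge eE)).
    exact: subsetP (partition_sub pS h0) q0 h1.
  have E := tame_phi_inj tG (sub s q sS qs) (sub s' q' s'S qs') qx q'x.
  by rewrite (partition_inj pS sS s'S qs) // E.
Qed.

Lemma card_att_strand e s : e \in edges G -> s \in strands G ::&: e ->
  #|att G s| = 2.
Proof.
move=> eE; rewrite inE => /andP[sS se]; rewrite card_att ?strand_card //.
  apply/subsetP => q qs; apply: (mem_epoints (mem_edge eE)); exact: (subsetP se).
by move=> q qs; apply: (tame_phi_edges tG eE); apply: (subsetP se).
Qed.

Lemma strand_att_color s x y : s \in strands G ->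
  x \in att G s -> y \in att G s -> vcol G x = vcol G y.
Proof.
move=> sS /attP[q qs qx] /attP[q' q's q'y].
have [|X XE sX] := tame_blocks_edge tG (B := s); first by rewrite inE sS orbT.
have h q0 : q0 \in s -> q0 \in epoints G.
  by move=> h0; apply: mem_epoints XE _; apply: (subsetP sX).
rewrite -(tame_ecol tG (h q qs) qx) -(tame_ecol tG (h q' q's) q'y).
exact: (tame_strands tG sS qs q's).
Qed.

Lemma in_vertex v B x : v \in vertices G -> B \in preedges G :|: chords G ->
  x \in B -> x \in v -> B \subset v.
Proof.
move=> vV BB xB xv; have [v' v'V Bv'] := tame_blocks_vertex tG BB.
rewrite (partition_inj (tame_vertices tG) vV v'V xv) //; exact: (subsetP Bv').
Qed.

End TameTheory.

End Tame.

(** * Contraction *)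

Section Contraction.

Variables (D : nat) (vp ep : finType) (G : colored_graph D vp ep) (e : {set ep}).
Hypotheses (tG : tame G) (eE : e \in edges G).
Let S := att G e.

Let eX : e \in edges G :|: shes G := mem_edge eE.

Let S_vpoints : S \subset vpoints G := att_vpoints tG eX.

Lemma met_chords_partition : partition (met_chords G e) (cover (met_chords G e)).
Proof.
case/and3P: (tame_chords tG) => _ tc c0; have sub : met_chords G e \subset chords G.
  by apply/subsetP => c; rewrite inE => /andP[].
by apply/and3P; split; [|exact: trivIsetS tc|apply: contra c0; apply: (subsetP sub)].
Qed.

Lemma att_sub_met : S \subset cover (met_chords G e).
Proof.
apply/subsetP => x xS.
have [c cC xc] := partition_mem (tame_chords tG) (subsetP S_vpoints x xS).
apply/bigcupP; exists c => //; rewrite inE cC /=.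
by apply/pred0Pn; exists x; rewrite /= xc.
Qed.

(** A component that is not a cycle is a path: the met chords match all its points, the strands of
    [e] only those in [S], and the points left over are its two ends. *)
Lemma new_chord_card K : K \in edge_comps G e :\: inner_faces G e ->
  #|K :\: S| = 2.
Proof.
rewrite !inE => /andP[nin Kc]; rewrite Kc /= in nin.
apply: (card_matching_component met_chords_partition
  (att_strands_partition tG eE) att_sub_met _ Kc nin) => B.
rewrite inE => /orP[|/imsetP[s sS ->]]; last by rewrite (card_att_strand tG eE sS).
by rewrite inE => /andP[/(tame_chord_card tG)].
Qed.

(** Strands preserve the ordered color (i, j), but chords may exchange i and j; only the unordered
    pair is constant along a path. This is why [tame] constrains chords by [color_pair]. *)
Lemma edge_comp_color K x y : K \in edge_comps G e -> x \in K -> y \in K ->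
  color_pair G x = color_pair G y.
Proof.
apply: comps_const => a b _ _ /same_blockP[B]; rewrite inE.
case/orP => [|/imsetP[s]]; rewrite inE => /andP[h _].
  by case/andP; apply: (tame_chord_color tG).
by move=> -> /andP[ha hb]; rewrite /color_pair (strand_att_color tG h ha hb).
Qed.

Let vpoints' : {set vp} := vpoints (contract G e).

Lemma end_vertices_sub : end_vertices G e \subset vertices G.
Proof. by apply/subsetP => v; rewrite inE => /andP[]. Qed.

Lemma att_sub_end_vertices : S \subset cover (end_vertices G e).
Proof.
apply/subsetP => x xS.
have [v vV xv] := partition_mem (tame_vertices tG) (subsetP S_vpoints x xS).
apply/bigcupP; exists v => //; rewrite inE vV.
by apply/pred0Pn; exists x; rewrite /= xv.
Qed.

Lemma vertices_partition_contract :
  partition (vertices (contract G e)) (vpoints G :\: S).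
Proof.
have pV := tame_vertices tG.
have pN := comps_partition
  (same_block (contract_preedges G e :|: contract_chords G e))
  (cover (end_vertices G e) :\: S).
have nd v x : v \in vertices G :\: end_vertices G e -> x \in v ->
    x \in cover (end_vertices G e) -> False.
  rewrite inE => /andP[nv vV] xv /bigcupP[w wE xw]; case/negP: nv.
  by rewrite (partition_inj pV vV (subsetP end_vertices_sub w wE) xv xw).
apply: partitionI => [|v|x|v v' x] /=.
- case/and3P: pV => _ _ V0; case/and3P: pN => _ _ N0.
  by rewrite inE negb_or N0 andbT inE negb_and V0 orbT.
- rewrite inE => /orP[vV|/(partition_sub pN)/subset_trans]; last first.
    apply; apply: setSD; apply/bigcupsP => w wE.
    exact: partition_sub pV (subsetP end_vertices_sub w wE).
  apply/subsetP => x xv; have := vV; rewrite inE => /andP[_ vV'].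
  rewrite inE (subsetP (partition_sub pV vV') x xv) andbT.
  by apply/negP => /(subsetP att_sub_end_vertices); apply: nd vV xv.
- rewrite inE => /andP[xS xV]; have [v vV xv] := partition_mem pV xV.
  have [vE|vE] := boolP (v \in end_vertices G e); last first.
    by exists v => //; rewrite inE inE vE vV.
  have [|w wN xw] := partition_mem pN (x := x).
    by rewrite inE xS; apply/bigcupP; exists v.
  by exists w => //; rewrite inE wN orbT.
- have nN w : w \in comps (same_block (contract_preedges G e :|: contract_chords G e))
      (cover (end_vertices G e) :\: S) -> x \in w -> x \in cover (end_vertices G e).
    by move=> wN xw; have /subsetP/(_ x xw) := partition_sub pN wN; case/setDP.
  rewrite !(in_setU v) !(in_setU v') => /orP[vV|vN] /orP[vV'|vN'] xv xv'.
  + move: vV vV'; rewrite !inE => /andP[_ vV] /andP[_ vV'].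
    exact: (partition_inj pV vV vV' xv xv').
  + by case: (nd _ _ vV xv (nN _ vN' xv')).
  + by case: (nd _ _ vV' xv' (nN _ vN xv)).
  + exact: partition_inj pN vN vN' xv xv'.
Qed.

Lemma vpoints_contract : vpoints (contract G e) = vpoints G :\: S.
Proof. by case/and3P: vertices_partition_contract => /eqP. Qed.

Lemma edge_comps_partition : partition (edge_comps G e) (cover (met_chords G e)).
Proof. exact: comps_partition. Qed.

Lemma cover_met_sub : cover (met_chords G e) \subset vpoints G.
Proof.
apply/bigcupsP => c; rewrite inE => /andP[cC _].
exact: partition_sub (tame_chords tG) cC.
Qed.

Lemma chords_partition_contract :
  partition (chords (contract G e)) (vpoints G :\: S).
Proof.
have pC := tame_chords tG; have pK := edge_comps_partition.
have nm c x : c \in chords G :\: met_chords G e -> x \in c ->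
    x \in cover (met_chords G e) -> False.
  move=> /setDP[cC nc] xc /bigcupP[c' c'M xc']; case/negP: nc.
  have c'C : c' \in chords G by move: c'M; rewrite inE => /andP[].
  by rewrite (partition_inj pC cC c'C xc xc').
have Kmet K x : K \in edge_comps G e :\: inner_faces G e -> x \in K ->
    x \in cover (met_chords G e).
  by case/setDP => Kc _; apply: (subsetP (partition_sub pK Kc)).
apply: partitionI => [|c|x xV|c c' x] /=.
- rewrite inE negb_or; apply/andP; split.
    by case/and3P: pC => _ _ C0; rewrite inE negb_and C0 orbT.
  by apply/imsetP => -[K /new_chord_card + E]; rewrite -/S -E cards0.
- rewrite inE => /orP[cC|/imsetP[K KI ->]].
    have := cC; rewrite inE => /andP[_ cC'].
    apply/subsetP => x xc; rewrite inE (subsetP (partition_sub pC cC')) // andbT.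
    by apply/negP => /(subsetP att_sub_met); apply: nm cC xc.
  apply: setSD; apply: subset_trans cover_met_sub.
  by apply/subsetP => x; apply: Kmet.
- case/setDP: xV => xV xS.
  have [xm|xm] := boolP (x \in cover (met_chords G e)).
    have [K Kc xK] := partition_mem pK xm.
    have KI : K \in edge_comps G e :\: inner_faces G e.
      rewrite inE Kc andbT inE Kc /=; apply: contra xS => /subsetP; exact.
    exists (K :\: S); last by rewrite inE xS.
    by rewrite inE orbC; apply/orP; left; apply: imset_f.
  have [c cC xc] := partition_mem pC xV; exists c => //.
  rewrite inE inE cC andbT; apply/orP; left; apply: contra xm => cm.
  by apply/bigcupP; exists c.
- rewrite !(in_setU c) !(in_setU c').
  case/orP => [cC|/imsetP[K KI ->]] /orP[c'C|/imsetP[K' KI' ->]] xc xc'.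
  + by move: cC c'C => /setDP[cC _] /setDP[c'C _]; apply: partition_inj pC _ _ xc xc'.
  + by case/setDP: xc' => xc' _; case: (nm _ _ cC xc (Kmet _ _ KI' xc')).
  + by case/setDP: xc => xc _; case: (nm _ _ c'C xc' (Kmet _ _ KI xc)).
  + move: KI KI' xc xc' => /setDP[Kc _] /setDP[K'c _] /setDP[xc _] /setDP[xc' _].
    by rewrite (partition_inj pK Kc K'c xc xc').
Qed.

Lemma preedges_partition_contract :
  partition (preedges (contract G e)) (vpoints G :\: S).
Proof.
have pP := tame_preedges tG.
apply: partitionI => [|P|x|P P' x] /=.
- by case/and3P: pP => _ _ P0; rewrite inE negb_and P0.
- rewrite inE => /andP[PP dP]; rewrite subsetD (partition_sub pP PP).
  exact: dP.
- case/setDP => xV xS; have [P PP xP] := partition_mem pP xV.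
  exists P => //; rewrite inE PP /=; have /orP[/subsetP h|//] := preedge_att tG eE PP.
  by rewrite /S h in xS.
- by rewrite !inE => /andP[PP _] /andP[PP' _]; apply: partition_inj pP _ _.
Qed.

Lemma blocks_vertex_contract B :
  B \in preedges (contract G e) :|: chords (contract G e) ->
  exists2 v, v \in vertices (contract G e) & B \subset v.
Proof.
move=> BB; pose R := same_block (contract_preedges G e :|: contract_chords G e).
have pN := comps_partition R (cover (end_vertices G e) :\: S).
have BV : B \subset vpoints G :\: S.
  by move: BB; rewrite inE => /orP[/(partition_sub preedges_partition_contract)|
    /(partition_sub chords_partition_contract)].
have [x xB] : exists x, x \in B.
  by move: BB; rewrite inE => /orP[/(partition_nonempty preedges_partition_contract)|
    /(partition_nonempty chords_partition_contract)].
have inN : B \subset cover (end_vertices G e) ->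
    exists2 v, v \in vertices (contract G e) & B \subset v.
  move=> Bend; have Bc : B \subset cover (end_vertices G e) :\: S.
    by rewrite subsetD Bend; move: BV; rewrite subsetD => /andP[].
  have [w wN xw] := partition_mem pN (subsetP Bc x xB).
  exists w; first by rewrite inE wN orbT.
  apply/subsetP => y yB; apply: (comps_step wN xw (subsetP Bc y yB)).
  by apply/orP; left; apply/same_blockP; exists B; rewrite ?xB.
have old : B \in preedges G :|: chords G ->
    exists2 v, v \in vertices (contract G e) & B \subset v.
  move=> /(tame_blocks_vertex tG)[v vV Bv].
  have [vE|vE] := boolP (v \in end_vertices G e).
    by apply: inN; apply: subset_trans Bv (bigcup_sup _ vE).
  by exists v => //; rewrite inE inE vE vV.
move: BB; rewrite /= !inE => /orP[/andP[BP _]|/orP[/andP[_ BC]|]].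
- by apply: old; rewrite inE BP.
- by apply: old; rewrite inE BC orbT.
(* A new chord has its ends on chords met by [e], and each of these lies inside an end vertex of
   [e]. *)
case/imsetP => K /setDP[Kc _] BE; apply: inN; rewrite BE.
apply: subset_trans (subsetDl _ _) _.
apply: subset_trans (partition_sub edge_comps_partition Kc) _.
apply/bigcupsP => c; rewrite inE => /andP[cC /pred0Pn[z /andP[zc zS]]].
have [|v vV cv] := tame_blocks_vertex tG (B := c); first by rewrite inE cC orbT.
apply: (subset_trans cv); apply: (bigcup_sup v); rewrite inE vV.
by apply/pred0Pn; exists z; rewrite /= (subsetP cv z zc).
Qed.

Lemma edge_blocks_contract (P : {set {set ep}}) X :
  partition (P ::&: X) X -> X \in edges G :|: shes G -> X != e ->
  (P :\: (P ::&: e)) ::&: X = P ::&: X.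
Proof.
move=> pX XE ne; apply/setP => B; rewrite !inE.
have [BP|//] := boolP (B \in P); have [BX|] := boolP (B \subset X); last by rewrite andbF.
rewrite /= !andbT; apply: contra ne => Be.
have [|q qB] := partition_nonempty pX (B := B); first by rewrite inE BP.
by rewrite (edge_inj tG XE eX (subsetP BX q qB) (subsetP Be q qB)).
Qed.

Lemma mem_edge_contract X : X \in edges (contract G e) :|: shes (contract G e) ->
  X \in edges G :|: shes G /\ X != e.
Proof.
rewrite /= !inE => /orP[/andP[-> ->] //|Xs]; rewrite Xs orbT; split=> //.
by apply: contraTneq Xs => ->; rewrite (disjointFr (tame_edges_shes tG) eE).
Qed.

Lemma mem_epoints_contract q : q \in epoints (contract G e) ->
  q \in epoints G /\ q \notin e.
Proof.
case/bigcupP => X /mem_edge_contract[XE ne] qX; split.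
  exact: mem_epoints XE qX.
by apply: contra ne => qe; rewrite (edge_inj tG XE eX qX qe).
Qed.

Lemma tame_contract : tame (ccontract G e).
Proof.
have sub : edges (contract G e) :|: shes (contract G e) \subset edges G :|: shes G.
  by apply/subsetP => X /mem_edge_contract[].
split.
- by rewrite vpoints_contract; apply: vertices_partition_contract.
- by rewrite vpoints_contract; apply: chords_partition_contract.
- by rewrite vpoints_contract; apply: preedges_partition_contract.
- exact: blocks_vertex_contract.
- move=> c /=; rewrite inE => /orP[/setDP[/(tame_chord_card tG)] //|].
  by case/imsetP => K /new_chord_card + ->.
- move=> c x y /=; rewrite inE => /orP[/setDP[h _]|].
    exact: (tame_chord_color tG h).
  case/imsetP => K /setDP[Kc _] -> /setDP[xK _] /setDP[yK _].
  exact: (edge_comp_color Kc xK yK).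
- by move=> P /=; rewrite inE => /andP[/(tame_preedge_card tG)].
- by move=> P x y /=; rewrite inE => /andP[/(tame_preedge_color1 tG)h _]; apply: h.
- by move=> P x y /=; rewrite inE => /andP[/(tame_preedge_color2 tG)h _]; apply: h.
- by move=> x; rewrite vpoints_contract => /setDP[/(tame_color_neq tG)].
- apply: disjointWl (tame_edges_shes tG); exact: subD1set.
- exact: trivIsetS sub (tame_edges_disjoint tG).
- move=> X /mem_edge_contract[XE ne] /=.
  rewrite (edge_blocks_contract (ends_partition tG XE) XE ne).
  rewrite (edge_blocks_contract (strands_partition tG XE) XE ne).
  exact: (tame_edges tG XE).
- move=> B BB; have BB' : B \in ends G :|: strands G.
    by move: BB; rewrite /= !inE => /orP[/andP[_ ->]|/andP[_ ->]]; rewrite ?orbT.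
  have [X XE BX] := tame_blocks_edge tG BB'.
  have ne : X != e.
    apply/eqP => E; move: BB; rewrite /= !inE -E BX !andbT.
    by case: (B \in ends G); case: (B \in strands G).
  exists X => //; move: XE; rewrite /= !inE ne => /orP[] ->; by rewrite ?orbT.
- by move=> f /= /setD1P[_ fE]; apply: (tame_phi_edges tG fE).
- move=> h /= hS; have [_ ne] : h \in edges G :|: shes G /\ h != e.
    by apply: mem_edge_contract; rewrite /= inE hS orbT.
  have [B BB hB] := tame_phi_shes tG hS; exists B => //.
  rewrite /= (edge_blocks_contract (ends_partition tG _)) //; exact: mem_she.
- move=> q q' x /mem_epoints_contract[h _] /mem_epoints_contract[h' _].
  exact: (tame_phi_inj tG h h').
(* The pre-edge of a remaining end survives: if it met [att G e], injectivity of [phi] would make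
   [B] an end of [e], and those were removed. *)
- move=> B /= /setDP[BE nB] phiB; have BP := tame_phi_ends tG BE phiB.
  rewrite inE BP /=; have /orP[sub'|//] := preedge_att tG eE BP.
  have [x xB] := partition_nonempty (tame_preedges tG) BP.
  have [|X XE BX] := tame_blocks_edge tG (B := B); first by rewrite inE BE.
  case/negP: nB; rewrite inE BE /=.
  suff <- : X = e by [].
  apply: (att_inj tG XE eX (x := x)); last exact: (subsetP sub').
  exact: subsetP (attS _ BX) x xB.
- rewrite vpoints_contract -(tame_phi_onto tG); apply/setP => x.
  apply/attP/setDP => [[q /mem_epoints_contract[qE nq] qx]|[/attP[q qE qx] nx]].
    split; first by apply/attP; exists q.
    apply: contra nq => /attP[q' q'e q'x].
    by rewrite (tame_phi_inj tG qE (mem_epoints eX q'e) qx q'x).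
  exists q => //; case/bigcupP: qE => X XE qX; apply/bigcupP; exists X => //=.
  have ne : X != e.
    by apply: contraNneq nx => Xe; apply/attP; exists q => //; rewrite -Xe.
  by move: XE; rewrite /= !inE ne.
- by move=> q x /mem_epoints_contract[qE _]; apply: (tame_ecol tG).
- by move=> s q q' /= /setDP[h _]; apply: (tame_strands tG).
- by move=> X q q' /mem_edge_contract[XE _]; apply: (tame_edge_color tG XE).
Qed.

End Contraction.

(** * Colored tensor graphs *)

Lemma partition_cover_refine (T : finType) (V P : {set {set T}}) :
  trivIset V -> (forall v, v \in V -> partition (P ::&: v) v) ->
  (forall B, B \in P -> exists2 v, v \in V & B \subset v) ->
  partition P (cover V).
Proof.
move=> tV pP hP; have mP B (v : {set T}) : B \in P -> B \subset v -> B \in P ::&: v.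
  by rewrite inE => -> ->.
apply: partitionI => [|B /hP[v vV Bv]|x /bigcupP[v vV xv]|B B' x BP B'P xB xB'].
- apply/negP => P0; have [v vV sv] := hP _ P0.
  by have /and3P[_ _] := pP v vV; rewrite inE P0 sub0set.
- exact: subset_trans Bv (bigcup_sup _ vV).
- have [B] := partition_mem (pP v vV) xv; rewrite inE => /andP[BP _].
  by exists B.
- have [v vV Bv] := hP B BP; have [v' v'V Bv'] := hP B' B'P.
  have E : v = v'.
    exact: (trivIset_inj tV vV v'V (subsetP Bv x xB) (subsetP Bv' x xB')).
  apply: (partition_inj (pP v vV) _ _ xB xB'); first exact: mP.
  by apply: mP => //; rewrite E.
Qed.

Lemma pair_of_card2 (T : finType) (c : {set T}) x :
  #|c| = 2 -> x \in c -> exists2 y, y != x & c = [set x; y].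
Proof.
move=> c2 xc; have /cards1P[y cy] : #|c :\ x| == 1.
  by have := cardsD1 x c; rewrite xc c2; lia.
have : y \in c :\ x by rewrite cy inE.
case/setD1P => nyx _; exists y => //.
by rewrite -cy setD1K.
Qed.

Section ColoredTensorGraph.

Variables (D : nat) (vp ep : finType) (G : colored_graph D vp ep).
Hypothesis hG : is_hectg G.

Let hH : is_hesg D G := hectg_hesg hG.

Lemma hectg_preedges_partition : partition (preedges G) (vpoints G).
Proof.
apply: partition_cover_refine (hesg_vertices_disjoint hH) _ _ => [v vV|B BP].
  by have [/and4P[]] := hesg_vertices hH vV.
by apply: (hesg_blocks_vertex hH); rewrite inE BP.
Qed.

Lemma hectg_chords_partition : partition (chords G) (vpoints G).
Proof.
apply: partition_cover_refine (hesg_vertices_disjoint hH) _ _ => [v vV|B BP].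
  by have [/and4P[]] := hesg_vertices hH vV.
by apply: (hesg_blocks_vertex hH); rewrite inE BP orbT.
Qed.

Lemma hectg_vertices_partition : partition (vertices G) (vpoints G).
Proof.
apply/and3P; split=> //; first exact: hesg_vertices_disjoint hH.
exact: hesg_vertices_nontrivial hH.
Qed.

Lemma hectg_chord_card c : c \in chords G -> #|c| = 2.
Proof.
move=> cC; have [|v vV cv] := hesg_blocks_vertex hH (B := c).
  by rewrite inE cC orbT.
have [/and4P[_ _ _ /forall_inP h] _] := hesg_vertices hH vV.
by apply/eqP/h; rewrite inE cC.
Qed.

Lemma hectg_point x : x \in vpoints G -> exists X B q,
  [/\ X \in edges G :|: shes G, B \in ends G ::&: X, q \in B,
      phi G q = Some x & att G B \in preedges G].
Proof.
rewrite -(hesg_phi_onto hH) => /attP[q /bigcupP[X XE qX] qx].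
have pB : partition (ends G ::&: X) X.
  by have /and5P[_ _ /and3P[]] := hectg_edges_rank hG XE.
have [B BX qB] := partition_mem pB qX; exists X, B, q; split=> //.
have [BE sB] : B \in ends G /\ B \subset X by apply/andP; rewrite inE in BX.
apply: (hesg_phi_ends hH BE) => q' q'B; move: XE; rewrite inE.
case/orP => XE; first exact: (hesg_phi_edges hH XE (subsetP sB q' q'B)).
have [B0 B0X h] := hesg_phi_shes hH XE.
rewrite h ?(subsetP sB) //; have qB0 : q \in B0 by rewrite -h // qx.
by rewrite (partition_inj pB B0X BX qB0 qB).
Qed.

Lemma hectg_preedge P x : P \in preedges G -> x \in P -> exists X B q,
  [/\ X \in edges G :|: shes G, B \in ends G ::&: X, q \in B,
      phi G q = Some x & att G B = P].
Proof.
move=> PP xP.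
have [X [B [q [XE BX qB qx BP]]]] :=
  hectg_point (subsetP (partition_sub hectg_preedges_partition PP) x xP).
exists X, B, q; split=> //.
apply: (partition_inj hectg_preedges_partition BP PP _ xP).
by apply/attP; exists q.
Qed.

Lemma mem_end_epoints X B q : X \in edges G :|: shes G ->
  B \in ends G ::&: X -> q \in B -> q \in epoints G.
Proof.
move=> XE; rewrite inE => /andP[_ BX] qB; apply/bigcupP; exists X => //.
exact: subsetP BX q qB.
Qed.

Lemma hectg_preedge_color P x y : P \in preedges G -> x \in P -> y \in P ->
  (vcol G x).1 = (vcol G y).1.
Proof.
move=> PP xP yP; have [X [B [q [XE BX qB qx PE]]]] := hectg_preedge PP xP.
move: yP; rewrite -PE => /attP[q' q'B q'y].
rewrite -(hectg_ecol hG (mem_end_epoints XE BX qB) qx).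
rewrite -(hectg_ecol hG (mem_end_epoints XE BX q'B) q'y).
move: BX; rewrite inE => /andP[_ sB].
by apply: (hectg_edge_color hG XE); apply: (subsetP sB).
Qed.

Lemma hectg_chord_swap x y : x != y -> [set x; y] \in chords G ->
  (vcol G x).2 = (vcol G y).1.
Proof.
move=> nxy cC; have sub := partition_sub hectg_chords_partition cC.
have [X [B [q [XE BX qB qx _]]]] := hectg_point (subsetP sub x (set21 _ _)).
have [Y [C [q' [YE CY qC qy _]]]] := hectg_point (subsetP sub y (set22 _ _)).
have qE := mem_end_epoints XE BX qB; have q'E := mem_end_epoints YE CY qC.
by rewrite (hectg_vcol hG qE q'E qx qy nxy cC) /= (hectg_ecol hG q'E qy).
Qed.

Lemma hectg_partner x : x \in vpoints G ->
  exists y, [/\ y != x, [set x; y] \in chords G & (vcol G x).2 = (vcol G y).1].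
Proof.
move=> xV; have [c cC xc] := partition_mem hectg_chords_partition xV.
have [y nyx E] := pair_of_card2 (hectg_chord_card cC) xc.
exists y; rewrite -E; split=> //; apply: hectg_chord_swap; first by rewrite eq_sym.
by rewrite -E.
Qed.

(** Two pre-edges of a vertex attached to different edges or half-edges have different colors by
    properness. They cannot share an edge, which would be a loop in a bipartite graph, nor a
    half-edge, which has a single attached end. *)
Lemma hectg_vertex_colors v P P' x x' : v \in vertices G ->
  P \in preedges G ::&: v -> P' \in preedges G ::&: v -> P != P' ->
  x \in P -> x' \in P' -> (vcol G x).1 != (vcol G x').1.
Proof.
rewrite !inE => vV /andP[PP Pv] /andP[PP' Pv'] nP xP xP'.
have [X [B [q [XE BX qB qx PE]]]] := hectg_preedge PP xP.
have [X' [B' [q' [XE' BX' qB' qx' PE']]]] := hectg_preedge PP' xP'.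
have [BXs BXs'] : B \subset X /\ B' \subset X'.
  by move: BX BX'; rewrite !inE => /andP[_ ->] /andP[_ ->].
rewrite -(hectg_ecol hG (mem_end_epoints XE BX qB) qx).
rewrite -(hectg_ecol hG (mem_end_epoints XE' BX' qB') qx').
have [XX|nX] := eqVneq X X'; last first.
  apply: (hectg_proper hG XE XE' nX _ (subsetP BXs q qB) (subsetP BXs' q' qB')).
  apply/pred0Pn; exists v; rewrite /= !inE vV /=; apply/andP; split; apply/pred0Pn.
    exists x; rewrite /= (subsetP Pv) //; apply/attP; exists q => //.
    exact: (subsetP BXs).
  exists x'; rewrite /= (subsetP Pv') //; apply/attP; exists q' => //.
  exact: (subsetP BXs').
have nB : B != B' by apply: contraNneq nP => E; rewrite -PE -PE' E.
subst X'; have /and5P[_ _ /and3P[pB /eqP cB _] _ _] := hectg_edges_rank hG XE.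
have endsE : ends G ::&: X = [set B; B'].
  apply/eqP; rewrite eq_sym eqEcard cB cards2 nB subUset !sub1set BX BX' //.
move: XE; rewrite inE => /orP[XE|XE].
  (* Both ends of [X] would be attached inside [v], so [v] would be the only end vertex and would
     lie on both sides of the bipartition. *)
  have [U hU] := hectg_bipartite hG; have [] := hU X XE.
  have only w : w \in end_vertices G X -> w = v.
    rewrite inE => /andP[wV /pred0Pn[z /andP[zw /attP[q0 q0X q0z]]]].
    have [B0] := partition_mem pB q0X; rewrite endsE !inE => B0E q0B.
    apply: (trivIset_inj (hesg_vertices_disjoint hH) wV vV zw).
    have zB : z \in att G B0 by apply/attP; exists q0.
    case/orP: B0E => /eqP E; move: zB; rewrite E ?PE ?PE'; exact: subsetP.
  case/set0Pn => w /setIP[/only ->] vU /set0Pn[w' /setDP[/only ->]].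
  by rewrite vU.
have [B0 B0X h] := hesg_phi_shes hH XE.
have q0 : q \in B0 by rewrite -h ?qx ?(subsetP BXs).
have q0' : q' \in B0 by rewrite -h ?qx' ?(subsetP BXs').
case/negP: nB; rewrite (partition_inj pB BX B0X qB q0).
by rewrite (partition_inj pB BX' B0X qB' q0').
Qed.

Lemma hectg_partner_preedge x : x \in vpoints G -> exists y v P P',
  [/\ v \in vertices G, [set x; y] \in chords G, (vcol G x).2 = (vcol G y).1 &
   [/\ P \in preedges G ::&: v, P' \in preedges G ::&: v, P != P', x \in P &
       y \in P']].
Proof.
move=> xV; have [y [nyx cC xy]] := hectg_partner xV.
have [|v vV cv] := hesg_blocks_vertex hH (B := [set x; y]).
  by rewrite inE cC orbT.
have yV := subsetP (partition_sub hectg_chords_partition cC) y (set22 _ _).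
have pv : partition (preedges G ::&: v) v by have [/and4P[]] := hesg_vertices hH vV.
have [P PP xP] := partition_mem pv (subsetP cv x (set21 _ _)).
have [P' PP' yP'] := partition_mem pv (subsetP cv y (set22 _ _)).
exists y, v, P, P'; split=> //; split=> //.
apply/eqP => E; have PG : P \in preedges G by move: PP; rewrite inE => /andP[].
by have := hectg_no_loop_chord hG PG cC; rewrite subUset !sub1set xP E yP'.
Qed.

Lemma hectg_tame : tame G.
Proof.
have pP := hectg_preedges_partition; split.
- exact: hectg_vertices_partition.
- exact: hectg_chords_partition.
- exact: pP.
- exact: (hesg_blocks_vertex hH).
- exact: hectg_chord_card.
- move=> c x y cC xc yc; have [<- //|nxy] := eqVneq x y.
  have [z nzx E] := pair_of_card2 (hectg_chord_card cC) xc.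
  have Ez : y = z by move: yc; rewrite E !inE eq_sym (negPf nxy) => /eqP.
  rewrite E -Ez in cC; rewrite /color_pair (hectg_chord_swap nxy cC).
  have -> : (vcol G y).2 = (vcol G x).1.
    by apply: hectg_chord_swap; rewrite 1?eq_sym // setUC.
  by rewrite setUC.
- exact: (hectg_preedges hG).
- exact: hectg_preedge_color.
(* The chords at [x] and [y] lead to pre-edges of the same color at the same vertex, hence to the
   same pre-edge. The complete vertex graph has a single chord between two pre-edges, so both points
   lie on one chord, and no chord is contained in [P]. *)
- move=> P x y PP xP yP cxy; have sP := partition_sub pP PP.
  have [x' [v [P1 [P' [vV cC xx' [P1v P'v nP xP1 x'P']]]]]] :=
    hectg_partner_preedge (subsetP sP x xP).
  have [y' [w [P2 [P'' [wV dC yy' [P2w P''w nP2 yP2 y'P'']]]]]] :=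
    hectg_partner_preedge (subsetP sP y yP).
  have E1 : P1 = P.
    by move: P1v; rewrite inE => /andP[P1G _]; apply: partition_inj pP P1G PP xP1 xP.
  have E2 : P2 = P.
    by move: P2w; rewrite inE => /andP[P2G _]; apply: partition_inj pP P2G PP yP2 yP.
  subst P1 P2.
  have Ew : w = v.
    move: P1v P2w; rewrite !inE => /andP[_ Pv] /andP[_ Pw].
    apply: (trivIset_inj (hesg_vertices_disjoint hH) wV vV (x := x)).
      exact: (subsetP Pw).
    exact: (subsetP Pv).
  subst w; have E : P'' = P'.
    apply/eqP; apply: contraT => nP'.
    have := hectg_vertex_colors vV P''w P'v nP' y'P'' x'P'.
    by rewrite -yy' -xx' cxy eqxx.
  subst P''; have /eqP/cards1P[c Ec] := hectg_complete hG vV P1v P'v nP.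
  have hc z z' : [set z; z'] \in chords G -> z \in P -> z' \in P' ->
      [set z; z'] = c.
    move=> zC zP z'P'; apply/set1P; rewrite -Ec !inE zC /=; apply/andP; split.
      by apply/pred0Pn; exists z; rewrite /= set21.
    by apply/pred0Pn; exists z'; rewrite /= set22.
  have : y \in [set x; x'] by rewrite (hc x x') // -(hc y y') // set21.
  rewrite !inE => /orP[/eqP -> //|/eqP Ey].
  have := hectg_no_loop_chord hG PP cC.
  by rewrite subUset !sub1set xP -Ey yP.
- move=> x xV; have [y [v [P [P' [vV _ -> [Pv P'v nP xP yP']]]]]] :=
    hectg_partner_preedge xV.
  exact: hectg_vertex_colors vV Pv P'v nP xP yP'.
- exact: (hesg_edges_shes hH).
- exact: (hesg_edges_disjoint hH).
- exact: (hectg_edges_rank hG).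
- exact: (hesg_blocks_edge hH).
- exact: (hesg_phi_edges hH).
- exact: (hesg_phi_shes hH).
- exact: (hesg_phi_inj hH).
- exact: (hesg_phi_ends hH).
- exact: (hesg_phi_onto hH).
- exact: (hectg_ecol hG).
- exact: (hectg_strands hG).
- exact: (hectg_edge_color hG).
Qed.

End ColoredTensorGraph.

Lemma w_colored_tame D (vp ep : finType) (G : colored_graph D vp ep) :
  w_colored G -> tame G.
Proof.
by elim=> [H /hectg_tame //|H e _ tH eE]; apply: tame_contract.
Qed.

(** * Cutting edges *)

Section Trace.

Variable T : finType.
Implicit Types (P Q : {set {set T}}) (A B S X : {set T}).

Definition trace P X : {set {set T}} := [set B :&: X | B in P] :\ set0.

Lemma traceP P X S :
  reflect (exists B, [/\ B \in P, ~~ [disjoint B & X] & S = B :&: X])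
          (S \in trace P X).
Proof.
rewrite !inE; apply: (iffP andP) => [[S0 /imsetP[B BP E]]|[B [BP BX ->]]].
  by exists B; split=> //; rewrite -setI_eq0 -E.
by rewrite setI_eq0; split=> //; apply: imset_f.
Qed.

Lemma trace_trivIset P X : trivIset P -> trivIset (trace P X).
Proof.
move=> tP; apply/trivIsetP => S S' /traceP[B [BP _ ->]] /traceP[B' [BP' _ ->]] ne.
rewrite -setI_eq0; apply: contraR ne => /set0Pn[x].
rewrite !inE => /andP[/andP[xB _] /andP[xB' _]].
by rewrite (trivIset_inj tP BP BP' xB xB').
Qed.

Lemma trace_partition P A X : partition P A -> X \subset A ->
  partition (trace P X) X.
Proof.
move=> pP XA; have tP : trivIset (trace P X).
  by apply: trace_trivIset; case/and3P: pP.
apply: partitionI => [|S|x xX|S S' x].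
- by rewrite !inE eqxx.
- by move=> /traceP[B [_ _ ->]]; apply: subsetIr.
- have [B BP xB] := partition_mem pP (subsetP XA x xX).
  exists (B :&: X); last by rewrite inE xB.
  by apply/traceP; exists B; split=> //; apply/pred0Pn; exists x; rewrite /= xB.
- exact: trivIset_inj.
Qed.

Lemma card_trace P X : trivIset P ->
  #|trace P X| = #|[set B in P | ~~ [disjoint B & X]]|.
Proof.
move=> tP; rewrite -[RHS](card_in_imset (f := fun B => B :&: X)).
  congr #|pred_of_set _|; apply/setP => S; apply/traceP/imsetP.
    by move=> [B [BP BX ->]]; exists B => //; rewrite inE BP.
  by move=> [B]; rewrite inE => /andP[BP BX] ->; exists B.
move=> B B'; rewrite !inE => /andP[BP /pred0Pn[x /andP[xB xX]]] /andP[BP' _] E.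
have : x \in B' :&: X by rewrite -E; apply/setIP.
by case/setIP => xB' _; apply: trivIset_inj tP BP BP' xB xB'.
Qed.

Lemma saturatedI P Q :
  (forall S B x y, S \in Q -> B \in P -> x \in B -> y \in B -> x \in S ->
     y \in S) -> saturated P Q.
Proof.
move=> h S B SQ BP; have [_|/pred0Pn[x /andP[xB xS]]] := boolP [disjoint B & S].
  by rewrite orbT.
by rewrite orbF; apply/subsetP => y yB; apply: h xB yB xS.
Qed.

Lemma saturated_trace P Q X : saturated P Q -> saturated (trace P X) (trace Q X).
Proof.
move=> sPQ; apply: saturatedI => _ _ x y /traceP[S [SQ _ ->]] /traceP[B [BP _ ->]].
move=> /setIP[xB _] /setIP[yB yX] /setIP[xS _]; rewrite inE yX andbT.
by have /orP[/subsetP|/disjointFr/(_ xB)] := sPQ S B SQ BP; [apply|rewrite xS].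
Qed.

(** The traces of [PA] and of [PB] both pair off [X], so they are equally many. The bound can
    therefore be stated with the traces of [PB], the pre-edges, which are comparable with edges. *)
Lemma traced_partition_bound A X PA PB PC QAB QAC QBC (K : finType) (c : T -> K) :
  partition PA A -> partition PB A -> partition PC A -> X \subset A ->
  (forall B, B \in PA -> ~~ [disjoint B & X] -> #|B :&: X| = 2) ->
  (forall B, B \in PB -> ~~ [disjoint B & X] -> #|B :&: X| = 2) ->
  (forall B, B \in PC -> ~~ odd #|B :&: X|) ->
  trivIset QAB -> saturated PA QAB -> saturated PB QAB ->
  trivIset QAC -> saturated PA QAC -> saturated PC QAC ->
  trivIset QBC -> saturated PB QBC -> saturated PC QBC ->
  (forall u : T -> 'F_2, (forall x, x \notin X -> u x = 0%R) ->
     constant_on u (trace PA X) -> constant_on u (trace PB X) ->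
     constant_on u (trace PC X) ->
     {in X &, forall x y, c x = c y -> u x = u y}) ->
  #|trace QAB X| + #|trace QAC X| + #|trace QBC X| <=
    #|trace PB X| + 2 * #|c @: X|.
Proof.
move=> pA pB pC XA A2 B2 evC tAB sAB1 sAB2 tAC sAC1 sAC2 tBC sBC1 sBC2 hc.
have c2 P : partition P A ->
    (forall B, B \in P -> ~~ [disjoint B & X] -> #|B :&: X| = 2) ->
    (forall B, B \in trace P X -> #|B| = 2) /\ #|trace P X| * 2 = #|X|.
  move=> pP P2; have P2' B : B \in trace P X -> #|B| = 2.
    by case/traceP => B' [BP dB ->]; apply: P2.
  by split=> //; rewrite (card_uniform_partition P2' (trace_partition pP XA)).
have [A2' cA] := c2 PA pA A2; have [B2' cB] := c2 PB pB B2.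
have -> : #|trace PB X| = #|trace PA X| by lia.
have sub Q S : S \in trace Q X -> S \subset X.
  by case/traceP => B [_ _ ->]; apply: subsetIr.
have n0 Q : set0 \notin trace Q X by rewrite !inE eqxx.
apply: (triple_partition_bound (PB := trace PB X) (PC := trace PC X) (X := X)) => //.
- exact: trace_partition pA XA.
- exact: trace_partition pB XA.
- exact: trace_partition pC XA.
- move=> B; rewrite inE => /orP[/B2'->//|/traceP[B' [BP _ ->]]]; exact: evC.
- by split=> //; [apply: trace_trivIset|apply: saturated_trace..|apply: sub].
- by split=> //; [apply: trace_trivIset|apply: saturated_trace..|apply: sub].
- by split=> //; [apply: trace_trivIset|apply: saturated_trace..|apply: sub].
Qed.

End Trace.

(** * Points, strands and closed faces of the cut graph *)

Section CutGraph.

Variables (D : nat) (vp ep : finType) (G : colored_graph D vp ep).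
Variable C : {set {set ep}}.
Hypotheses (tG : tame G) (CE : C \subset edges G).
Let A := ccut G C.

Lemma in_lift_e (X : {set ep}) q : (inl q \in lift_e vp X) = (q \in X).
Proof. by rewrite mem_imset // => ? ? []. Qed.

Lemma in_lift_eF (X : {set ep}) (x : vp) : (inr x \in lift_e vp X) = false.
Proof. by apply/imsetP => -[]. Qed.

Lemma in_lift_v (X : {set vp}) x : (inr x \in lift_v ep X) = (x \in X).
Proof. by rewrite mem_imset // => ? ? []. Qed.

Lemma in_lift_vF (X : {set vp}) (q : ep) : (inl q \in lift_v ep X) = false.
Proof. by apply/imsetP => -[]. Qed.

Lemma cut_endsP e B : e \in C -> B \in ends G ::&: e -> B \in cut_ends G C.
Proof.
by move=> eC; rewrite !inE => /andP[-> Be]; apply/existsP; exists e; rewrite eC.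
Qed.

Lemma cut_end_preedge B : B \in cut_ends G C -> att G B \in preedges G.
Proof.
rewrite inE => /andP[BE /existsP[e /andP[eC Be]]].
exact: (att_end_preedge tG (subsetP CE e eC) BE Be).
Qed.

Lemma epoints_cut_inl q : (inl q \in epoints A) = (q \in epoints G).
Proof.
apply/bigcupP/bigcupP => -[X].
  rewrite !inE => /orP[/imsetP[Y /setDP[YE _] ->]|/orP[/imsetP[Y YE ->]|]].
  - by rewrite in_lift_e => qY; exists Y => //; rewrite inE YE.
  - by rewrite in_lift_e => qY; exists Y => //; rewrite inE YE orbT.
  case/imsetP => B; rewrite inE => /andP[_ /existsP[e /andP[eC Be]]] ->.
  rewrite inE in_lift_e in_lift_vF orbF => qB; exists e.
    by rewrite inE (subsetP CE).
  exact: subsetP Be q qB.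
move=> XE qX; have [XC|XC] := boolP (X \in C).
  have [B BX qB] := partition_mem (ends_partition tG XE) qX.
  exists (lift_e vp B :|: lift_v ep (att G B)); last by rewrite inE in_lift_e qB.
  by apply/setUP; right; apply/setUP; right; apply/imset_f/(cut_endsP XC BX).
exists (lift_e vp X); last by rewrite in_lift_e.
case/setUP: XE => XE; apply/setUP; [left|right; apply/setUP; left].
  by apply: imset_f; rewrite inE XE XC.
exact: imset_f.
Qed.

Lemma epoints_cut_inr e x : e \in C -> x \in att G e -> inr x \in epoints A.
Proof.
move=> eC /attP[q qe qx]; have eE := mem_edge (subsetP CE e eC).
have [B BX qB] := partition_mem (ends_partition tG eE) qe.
apply/bigcupP; exists (lift_e vp B :|: lift_v ep (att G B)).
  by apply/setUP; right; apply/setUP; right; apply/imset_f/(cut_endsP eC BX).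
by rewrite inE in_lift_v orbC; apply/orP; left; apply/attP; exists q.
Qed.

Lemma strand_uncut X s : X \in edges G :|: shes G -> X \notin C ->
  s \in strands G ::&: X -> lift_e vp s \in strands A.
Proof.
move=> XE XC sX; have [q qs] := partition_nonempty (strands_partition tG XE) sX.
move: sX; rewrite inE => /andP[sS sX].
apply/setUP; left; apply: imset_f; rewrite inE sS andbT inE sS /=.
apply: contra XC => /existsP[e /andP[eC se]].
have eE := mem_edge (subsetP CE e eC).
by rewrite (edge_inj tG XE eE (subsetP sX q qs) (subsetP se q qs)).
Qed.

Lemma strand_cut e q x : e \in C -> q \in e -> phi G q = Some x ->
  [set inl q; inr x] \in strands A.
Proof.
move=> eC qe qx; apply/setUP; right.
apply/imsetP; exists (q, x) => //; rewrite inE /= qx eqxx andbT.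
by apply/bigcupP; exists e.
Qed.

Lemma she_notin_cut h : h \in shes G -> h \notin C.
Proof.
move=> hS; apply/negP => /(subsetP CE) hE.
by have := disjointFr (tame_edges_shes tG) hE; rewrite hS.
Qed.

(** The strand has two points and exactly one of them in the attached end, so the other one is
    external. *)
Lemma she_strand h s : h \in shes G -> s \in strands G ::&: h ->
  exists q q' x, [/\ s = [set q; q'], phi G q = Some x & phi G q' = None].
Proof.
move=> hS sh; have hX := mem_she hS; have [B BX hB] := tame_phi_shes tG hS.
have /cards1P[q E] : #|s :&: B| == 1 by rewrite (strand_end tG hX sh BX).
have /setIP[qs qB] : q \in s :&: B by rewrite E set11.
have [sS ssub] : s \in strands G /\ s \subset h by move: sh; rewrite inE => /andP[].
have [q' nq Es] := pair_of_card2 (strand_card tG sS) qs.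
have q's : q' \in s by rewrite Es set22.
have := hB q (subsetP ssub q qs); rewrite qB; case Ex: (phi G q) => [x|] // _.
exists q, q', x; split=> //; have := hB q' (subsetP ssub q' q's).
case: (boolP (q' \in B)) => [q'B|_]; last by case: (phi G q').
have : q' \in s :&: B by rewrite inE q's.
by rewrite E inE (negPf nq).
Qed.

(** Faces are replaced by their vertex points in order to be compared with chords and strand blocks.
    For closed faces nothing is lost, by [face_trace_inj]. *)
Definition face_trace (K : {set vp + (ep + vp)}) : {set vp} :=
  [set x | inl x \in K].

Lemma face_step K z z' : K \in faces A -> z \in K -> z' \in points A ->
  face_adj A z z' || face_adj A z' z -> z' \in K.
Proof. exact: comps_step. Qed.

Lemma vpoint_points x : (inl x \in points A) = (x \in vpoints G).
Proof.
rewrite inE mem_imset => [|? ? []//].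
by rewrite orbC; case: imsetP => // -[].
Qed.

Lemma epoint_points w : (inr w \in points A) = (w \in epoints A).
Proof.
rewrite inE [X in _ || X]mem_imset => [|? ? []//].
by case: imsetP => // -[].
Qed.

Lemma face_chord K c x y : K \in faces A -> c \in chords G ->
  x \in c -> y \in c -> inl x \in K -> inl y \in K.
Proof.
move=> KF cC xc yc xK; apply: (face_step KF xK).
  rewrite vpoint_points; exact: subsetP (partition_sub (tame_chords tG) cC) y yc.
by apply/orP; left; apply/same_blockP; exists c; rewrite ?xc.
Qed.

Lemma face_strand K e s x y : K \in faces A -> e \in edges G :\: C ->
  s \in strands G ::&: e -> x \in att G s -> y \in att G s ->
  inl x \in K -> inl y \in K.
Proof.
move=> KF /setDP[eE eC] se /attP[q qs qx] /attP[q' q's q'y] xK.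
have eX := mem_edge eE; have sS := strand_uncut eX eC se.
have qe q0 : q0 \in s -> q0 \in epoints G.
  move=> h; apply: mem_epoints eX _; move: se; rewrite inE => /andP[_ se].
  exact: subsetP se q0 h.
have qK : inr (inl q) \in K.
  apply: (face_step KF xK); first by rewrite epoint_points epoints_cut_inl qe.
  by rewrite /= qx eqxx.
have q'K : inr (inl q') \in K.
  apply: (face_step KF qK); first by rewrite epoint_points epoints_cut_inl qe.
  by apply/orP; left; apply/same_blockP; exists (lift_e vp s); rewrite ?in_lift_e ?qs.
apply: (face_step KF q'K); last by rewrite /= q'y eqxx.
rewrite vpoint_points -(tame_phi_onto tG); apply/attP; exists q' => //; exact: qe.
Qed.

Lemma mem_external w : w \in epoints A -> phi A w = None -> inr w \in external A.
Proof. by move=> wE pw; rewrite mem_imset ?inE ?wE ?pw // => ? ? []. Qed.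

(** Following the strand at [x] leads to an external point: the copy [inr x] if [X] is a cut edge,
    the other point of the strand if [X] is an original half-edge. The face would thus be open. *)
Lemma face_half_edge K X x : K \in closed_faces A ->
  X \in edges G :|: shes G -> X \notin edges G :\: C ->
  x \in att G X -> inl x \notin K.
Proof.
rewrite inE => /andP[KF dK] XE XC /attP[q qX qx]; apply/negP => xK.
have qE := mem_epoints XE qX.
have qK : inr (inl q) \in K.
  apply: (face_step KF xK); first by rewrite epoint_points epoints_cut_inl.
  by rewrite /= qx eqxx.
suff [w wK wext] : exists2 w, w \in K & w \in external A.
  by rewrite (disjointFr dK wK) in wext.
move: XE; rewrite inE => /orP[XE|XS].
  have XC' : X \in C by move: XC; rewrite inE XE andbT negbK.
  have xE : inr x \in epoints A.
    by apply: epoints_cut_inr XC' _; apply/attP; exists q.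
  exists (inr (inr x)); last exact: mem_external.
  apply: (face_step KF qK); first by rewrite epoint_points.
  apply/orP; left; apply/same_blockP; exists [set inl q; inr x].
    exact: strand_cut XC' qX qx.
  by rewrite set21 set22.
have XX := mem_she XS.
have [s sX qs] := partition_mem (strands_partition tG XX) qX.
have [q1 [q2 [x' [Es q1x q2N]]]] := she_strand XS sX.
have q2X : q2 \in X.
  by apply: (subsetP (partition_sub (strands_partition tG XX) sX)); rewrite Es set22.
have q2E : inl q2 \in epoints A by rewrite epoints_cut_inl (mem_epoints XX q2X).
exists (inr (inl q2)); last exact: mem_external.
apply: (face_step KF qK); first by rewrite epoint_points.
apply/orP; left; apply/same_blockP; exists (lift_e vp s).
  exact: strand_uncut XX (she_notin_cut XS) sX.
by rewrite !in_lift_e qs Es set22.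
Qed.

(** An edge point is either attached, and then joined to its vertex point, or external, and then not
    on a closed face. *)
Lemma closed_face_vpoint K : K \in closed_faces A ->
  exists2 x, x \in vpoints G & inl x \in K.
Proof.
rewrite inE => /andP[KF dK]; have pF : partition (faces A) (points A).
  exact: comps_partition.
have [[x|w] zK] := partition_nonempty pF KF; have := subsetP (partition_sub pF KF) _ zK.
  by rewrite vpoint_points => xV; exists x.
rewrite epoint_points => wE; case Ex: (phi A w) => [x|]; last first.
  by have := mem_external wE Ex; rewrite (disjointFr dK zK).
case: w => [q|y] // in wE zK Ex *; move: wE; rewrite epoints_cut_inl => qE.
have xV : x \in vpoints G by rewrite -(tame_phi_onto tG); apply/attP; exists q.
exists x => //; apply: (face_step KF zK); first by rewrite vpoint_points.
by rewrite /= in Ex; rewrite /= Ex eqxx.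
Qed.

Lemma face_trace_inj : {in closed_faces A &, injective face_trace}.
Proof.
move=> K K' KF K'F E; have [x xV xK] := closed_face_vpoint KF.
have : x \in face_trace K' by rewrite -E inE.
rewrite inE => xK'.
move: KF K'F; rewrite !inE => /andP[KF _] /andP[K'F _].
exact: partition_inj (comps_partition _ _) KF K'F xK xK'.
Qed.

End CutGraph.

(** * Ribbon graphs of color triples *)

Section ColorTriple.

Variables (D : nat) (vp ep : finType) (G : colored_graph D vp ep).
Variable C : {set {set ep}}.
Hypotheses (tG : tame G) (CE : C \subset edges G).
Variable abc : {set 'I_D.+1}.
Hypothesis abc3 : #|abc| = 3.
Let A := ccut G C.
Let Ei := edges G :\: C.

Definition color_points : {set vp} :=
  [set x in vpoints G | color_pair G x \subset abc].

Let X := color_points.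

Lemma color_points_sub : X \subset vpoints G.
Proof. by apply/subsetP => x; rewrite inE => /andP[]. Qed.

Lemma in_color_points x :
  (x \in X) = (x \in vpoints G) && ((vcol G x).1 \in abc) && ((vcol G x).2 \in abc).
Proof. by rewrite inE subUset !sub1set andbA. Qed.

Lemma chord_trace c : c \in chords G -> ~~ [disjoint c & X] -> #|c :&: X| = 2.
Proof.
move=> cC /pred0Pn[x /andP[xc xX]]; rewrite -(tame_chord_card tG cC).
suff /setIidPl-> : c \subset X by [].
apply/subsetP => y yc; move: xX; rewrite /= !inE => /andP[_].
rewrite (tame_chord_color tG cC xc yc) => ->; rewrite andbT.
exact: subsetP (partition_sub (tame_chords tG) cC) y yc.
Qed.

(** By pigeonhole: the [D] points of [P] have distinct second colors, all among the [D] colors other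
    than that of [P]. *)
Lemma preedge_second_colors P x : P \in preedges G -> x \in P ->
  [set (vcol G y).2 | y in P] = [set~ (vcol G x).1].
Proof.
move=> PP xP; apply/eqP; rewrite eqEcard; apply/andP; split.
  apply/subsetP => _ /imsetP[y yP ->]; rewrite !inE.
  rewrite (tame_preedge_color1 tG PP xP yP) eq_sym (tame_color_neq tG) //.
  exact: subsetP (partition_sub (tame_preedges tG) PP) y yP.
rewrite card_in_imset; last exact: (fun y z => tame_preedge_color2 tG PP).
by rewrite (tame_preedge_card tG PP) cardsC1 card_ord.
Qed.

(** The points kept are those whose second color is one of the two elements of [abc] other than the
    color of [P]. *)
Lemma preedge_trace P : P \in preedges G -> ~~ [disjoint P & X] ->
  #|P :&: X| = 2.
Proof.
move=> PP /pred0Pn[x /andP[xP /=]]; rewrite in_color_points.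
case/andP=> /andP[xV x1 x2].
have PV y : y \in P -> y \in vpoints G.
  exact: subsetP (partition_sub (tame_preedges tG) PP) y.
rewrite -(card_in_imset (f := fun y => (vcol G y).2)); last first.
  by move=> y z /setIP[yP _] /setIP[zP _]; apply: (tame_preedge_color2 tG PP).
have -> : [set (vcol G y).2 | y in P :&: X] = abc :\ (vcol G x).1.
  apply/setP => j; apply/imsetP/setD1P.
    move=> [y /setIP[yP]]; rewrite in_color_points => /andP[_ y2] ->; split=> //.
    by rewrite (tame_preedge_color1 tG PP xP yP) eq_sym (tame_color_neq tG) ?PV.
  move=> [nj jabc]; have : j \in [set~ (vcol G x).1] by rewrite !inE.
  rewrite -(preedge_second_colors PP xP) => /imsetP[y yP Ej]; exists y => //.
  rewrite inE yP in_color_points PV // -Ej jabc.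
  by rewrite (tame_preedge_color1 tG PP yP xP) x1.
by have := cardsD1 (vcol G x).1 abc; rewrite x1 abc3 add1n => -[<-].
Qed.

(* The pre-edges attached to half-edges of the cut graph. *)
Definition free_preedges : {set {set vp}} :=
  [set P in preedges G | [forall e in Ei, [disjoint P & att G e]]].

(** This is the third partition of the flags. Taking free pre-edges as blocks is harmless: their
    traces on the color points are even, closed faces avoid them, and a bubble contains all color
    points of a pre-edge that it meets. *)
Definition strand_blocks : {set {set vp}} :=
  [set att G s | s in [set s in strands G | [exists e in Ei, s \subset e]]]
  :|: free_preedges.

Definition edge_blocks : {set {set vp}} :=
  [set att G e | e in Ei] :|: free_preedges.

Lemma free_preedge P : P \in free_preedges -> P \in preedges G.
Proof. by rewrite inE => /andP[]. Qed.

Lemma free_preedge_disjoint P e x : P \in free_preedges -> e \in Ei -> x \in P ->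
  x \in att G e -> False.
Proof.
rewrite inE => /andP[_ /forall_inP h] eE xP xe.
by rewrite (disjointFr (h e eE) xP) in xe.
Qed.

Lemma internal_edge e : e \in Ei -> e \in edges G.
Proof. by case/setDP. Qed.

Lemma internal_strandP s :
  reflect (exists2 e, e \in Ei & s \in strands G ::&: e)
          (s \in [set s in strands G | [exists e in Ei, s \subset e]]).
Proof.
rewrite inE; apply: (iffP andP) => [[sS /existsP[e /andP[eE se]]]|[e eE]].
  by exists e => //; rewrite inE sS.
by rewrite inE => /andP[-> se]; split=> //; apply/existsP; exists e; rewrite eE.
Qed.

Lemma point_cases x : x \in vpoints G ->
  (exists2 e, e \in Ei & x \in att G e) \/
  (exists2 P, P \in free_preedges & x \in P).
Proof.
move=> xV; have [/existsP[e /andP[eE xe]]|none] :=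
  boolP [exists e in Ei, x \in att G e]; first by left; exists e.
right; have [P PP xP] := partition_mem (tame_preedges tG) xV; exists P => //.
rewrite inE PP; apply/forall_inP => e eE.
have /orP[/subsetP/(_ x xP) xe|//] := preedge_att tG (internal_edge eE) PP.
by case/negP: none; apply/existsP; exists e; rewrite eE.
Qed.

Lemma strand_blocks_partition : partition strand_blocks (vpoints G).
Proof.
have pP := tame_preedges tG.
apply: partitionI => [|B|x xV|B B' x].
- rewrite inE negb_or; apply/andP; split.
    apply/imsetP => -[s /internal_strandP[e eE se] E].
    by have := card_att_strand tG (internal_edge eE) se; rewrite -E cards0.
  by rewrite inE negb_and; case/and3P: pP => _ _ ->.
- case/setUP => [/imsetP[s /internal_strandP[e eE se] ->]|]; last first.
    by move/free_preedge/(partition_sub pP).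
  apply: subset_trans (att_vpoints tG (mem_edge (internal_edge eE))).
  by apply: attS; move: se; rewrite inE => /andP[].
- have [[e eE xe]|[P Pf xP]] := point_cases xV; last first.
    by exists P => //; rewrite inE Pf orbT.
  have [_ /imsetP[s se ->] xs] :=
    partition_mem (att_strands_partition tG (internal_edge eE)) xe.
  exists (att G s) => //; rewrite inE imset_f //.
  by apply/internal_strandP; exists e.
- have sub s e : s \in strands G ::&: e -> att G s \subset att G e.
    by rewrite inE => /andP[_ /attS].
  case/setUP => [/imsetP[s /internal_strandP[e eE se] ->]|Pf];
    case/setUP => [/imsetP[s' /internal_strandP[e' e'E s'e'] ->]|P'f] xB xB'.
  + have E : e = e'.
      apply: (att_inj tG (mem_edge (internal_edge eE)) (mem_edge (internal_edge e'E)));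
      [exact: subsetP (sub _ _ se) x xB|exact: subsetP (sub _ _ s'e') x xB'].
    subst e'.
    by apply: (partition_inj (att_strands_partition tG (internal_edge eE)) _ _ xB xB');
      apply: imset_f.
  + by case: (free_preedge_disjoint P'f eE xB' (subsetP (sub _ _ se) x xB)).
  + by case: (free_preedge_disjoint Pf e'E xB (subsetP (sub _ _ s'e') x xB')).
  + exact: partition_inj pP (free_preedge Pf) (free_preedge P'f) xB xB'.
Qed.

(** A strand keeps the ordered color, so its two attached points are both in [X] or both outside. A
    free pre-edge has two points in [X] or none. *)
Lemma strand_block_trace B : B \in strand_blocks -> ~~ odd #|B :&: X|.
Proof.
case/setUP => [/imsetP[s /internal_strandP[e eE se] ->]|/free_preedge PP].
  have sS : s \in strands G by move: se; rewrite inE => /andP[].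
  have [d|] := boolP [disjoint att G s & X].
    by move: d; rewrite -setI_eq0 => /eqP->; rewrite cards0.
  case/pred0Pn => x /andP[xs xX]; suff /setIidPl-> : att G s \subset X.
    by rewrite (card_att_strand tG (internal_edge eE) se).
  apply/subsetP => y ys; move: xX; rewrite /= !in_color_points.
  rewrite (strand_att_color tG sS xs ys) -!andbA => /andP[_ ->]; rewrite andbT.
  apply: (subsetP (att_vpoints tG (mem_edge (internal_edge eE)))).
  by apply: subsetP ys; apply: attS; move: se; rewrite inE => /andP[].
have [d|d] := boolP [disjoint B & X]; last by rewrite preedge_trace.
by move: d; rewrite -setI_eq0 => /eqP->; rewrite cards0.
Qed.

Lemma edge_blocks_inj B B' x : B \in edge_blocks -> B' \in edge_blocks ->
  x \in B -> x \in B' -> B = B'.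
Proof.
case/setUP => [/imsetP[e eE ->]|Pf]; case/setUP => [/imsetP[e' e'E ->]|P'f] xB xB'.
- have eX := mem_edge (internal_edge eE); have e'X := mem_edge (internal_edge e'E).
  by rewrite (att_inj tG eX e'X xB xB').
- by case: (free_preedge_disjoint P'f eE xB' xB).
- by case: (free_preedge_disjoint Pf e'E xB xB').
- exact: partition_inj (tame_preedges tG) (free_preedge Pf) (free_preedge P'f) xB xB'.
Qed.

Lemma edge_blocks_trivIset : trivIset edge_blocks.
Proof.
apply/trivIsetP => B B' BE B'E ne; rewrite -setI_eq0.
apply: contraR ne => /set0Pn[x /setIP[xB xB']].
by rewrite (edge_blocks_inj BE B'E xB xB').
Qed.

Lemma saturated_preedges_edge_blocks : saturated (preedges G) edge_blocks.
Proof.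
apply: saturatedI => S P x y /setUP[/imsetP[e eE ->]|Sf] PP xP yP xS.
  have /orP[/subsetP/(_ y yP)//|d] := preedge_att tG (internal_edge eE) PP.
  by have := disjointFr d xP; rewrite xS.
by rewrite -(partition_inj (tame_preedges tG) PP (free_preedge Sf) xP xS).
Qed.

Lemma saturated_strand_edge_blocks : saturated strand_blocks edge_blocks.
Proof.
apply: saturatedI => S B x y SE.
case/setUP => [/imsetP[s /internal_strandP[e eE se] ->]|Pf] xB yB xS.
  have sub : att G s \subset att G e by apply: attS; move: se; rewrite inE => /andP[].
  have eQ : att G e \in edge_blocks by rewrite inE imset_f.
  by rewrite -(edge_blocks_inj eQ SE (subsetP sub x xB) xS) (subsetP sub).
have BQ : B \in edge_blocks by rewrite inE Pf orbT.
by rewrite -(edge_blocks_inj BQ SE xB xS).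
Qed.

Definition face_traces : {set {set vp}} :=
  [set face_trace K | K in closed_faces A].

Lemma face_traces_trivIset : trivIset face_traces.
Proof.
apply/trivIsetP => _ _ /imsetP[K KF ->] /imsetP[K' K'F ->] ne; rewrite -setI_eq0.
apply: contraR ne => /set0Pn[x]; rewrite !inE => /andP[xK xK'].
move: KF K'F; rewrite !inE => /andP[KF _] /andP[K'F _].
by rewrite (partition_inj (comps_partition _ _) KF K'F xK xK').
Qed.

Lemma saturated_chords_faces : saturated (chords G) face_traces.
Proof.
apply: saturatedI => _ c x y /imsetP[K KF ->] cC xc yc; rewrite !inE.
move: KF; rewrite inE => /andP[KF _].
exact: (face_chord tG KF cC xc yc).
Qed.

Lemma saturated_strands_faces : saturated strand_blocks face_traces.
Proof.
apply: saturatedI => _ B x y /imsetP[K KF ->] BS xB yB; rewrite !inE => xK.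
have KF' : K \in faces A by move: KF; rewrite inE => /andP[].
case/setUP: BS => [/imsetP[s /internal_strandP[e eE se] E]|Pf].
  by rewrite E in xB yB; apply: (face_strand tG CE KF' eE se xB yB xK).
(* A free pre-edge is attached to a half-edge or to a cut edge, so it has no point on a closed face
   and this case is contradictory. *)
have xV : x \in vpoints G.
  exact: subsetP (partition_sub (tame_preedges tG) (free_preedge Pf)) x xB.
move: xV; rewrite -(tame_phi_onto tG) => /attP[q /bigcupP[Y YE qY] qx].
have xY : x \in att G Y by apply/attP; exists q.
have [YEi|nY] := boolP (Y \in Ei).
  by case: (free_preedge_disjoint Pf YEi xB xY).
by have := face_half_edge tG CE KF YE nY xY; rewrite xK.
Qed.

Lemma saturated_vertices (B : {set {set vp}}) : B \subset preedges G :|: chords G ->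
  saturated B (vertices G).
Proof.
move=> /subsetP sB; apply: saturatedI => v b x y vV bB xb yb xv.
exact: subsetP (in_vertex tG vV (sB b bB) xb xv) y yb.
Qed.

(** A free pre-edge is itself an edge block, whereas an uncut edge is one block but has at most two
    pre-edges; the second one is paid for by the last term. *)
Lemma preedge_trace_bound :
  #|trace (preedges G) X| <=
  #|trace edge_blocks X| + #|[set e in Ei | ~~ [disjoint att G e & X]]|.
Proof.
set E' := [set e in Ei | _].
have tP : trivIset (preedges G) by case/and3P: (tame_preedges tG).
rewrite !card_trace ?edge_blocks_trivIset //.
pose N := [set P in free_preedges | ~~ [disjoint P & X]].
have E'E e : e \in E' -> e \in Ei by rewrite inE => /andP[].
have attI : {in E' &, injective (att G)}.
  move=> e e' /[dup] eE' /E'E eE /E'E e'E E.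
  move: eE'; rewrite inE => /andP[_ /pred0Pn[x /andP[xe _]]].
  apply: (att_inj tG (mem_edge (internal_edge eE)) (mem_edge (internal_edge e'E)) xe).
  by rewrite -E.
have disj : [disjoint att G @: E' & N].
  rewrite -setI_eq0; apply/eqP/setP => B; rewrite in_set0.
  apply/negP => /setIP[/imsetP[e /E'E eE BE]].
  rewrite inE => /andP[Bf /pred0Pn[x /andP[xB _]]].
  by apply: (free_preedge_disjoint Bf eE xB); rewrite -BE.
have h1 : #|E'| + #|N| <= #|[set B in edge_blocks | ~~ [disjoint B & X]]|.
  have /eqP <- : #|att G @: E' :|: N| == #|E'| + #|N|.
    by rewrite -(card_in_imset attI) (leq_card_setU _ _).2.
  apply/subset_leq_card/subsetP => B /setUP[/imsetP[e eE' ->]|].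
    rewrite inE [_ \in edge_blocks]inE imset_f ?E'E //=.
    by move: eE'; rewrite inE => /andP[].
  by rewrite inE => /andP[Bf BX]; rewrite inE BX in_setU Bf orbT.
have h2 : #|[set P in preedges G | ~~ [disjoint P & X]]| <=
    #|N| + #|\bigcup_(e in E') [set att G B | B in ends G ::&: e]|.
  apply: leq_trans (leq_card_setU _ _).1; apply/subset_leq_card/subsetP => P.
  rewrite inE => /andP[PP PX].
  have [Pf|] := boolP (P \in free_preedges); first by rewrite inE inE Pf PX.
  rewrite inE PP /= => /forall_inPn[e eE /pred0Pn[x /andP[xP xe]]].
  rewrite inE; apply/orP; right; apply/bigcupP.
  have [B BE PB] := preedge_att_edge tG (internal_edge eE) PP xP xe.
  exists e; last by rewrite PB imset_f.
  rewrite inE eE /=; case/pred0Pn: PX => z /andP[zP zX]; apply/pred0Pn; exists z.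
  apply/andP; split=> //.
  have /orP[/subsetP/(_ z zP)//|d] := preedge_att tG (internal_edge eE) PP.
  by have := disjointFr d xP; rewrite (xe : x \in _).
have h3 : #|\bigcup_(e in E') [set att G B | B in ends G ::&: e]| <= 2 * #|E'|.
  rewrite mulnC -sum_nat_const.
  have sub e : e \in E' -> #|[set att G B | B in ends G ::&: e]| <= 2.
    move=> /E'E/internal_edge/mem_edge/(tame_edges tG)/and5P[_ _ /and3P[_ /eqP <- _] _ _].
    exact: leq_imset_card.
  elim/big_rec2: _ => [|e k S eE' h]; first by rewrite cards0.
  apply: leq_trans (leq_card_setU _ _).1 _; exact: leq_add (sub e eE') h.
lia.
Qed.


Lemma strands_partition_all : partition (strands G) (epoints G).
Proof.
apply: partition_cover_refine (tame_edges_disjoint tG) _ _ => [Y|s sS].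
  exact: (strands_partition tG).
by apply: (tame_blocks_edge tG); rewrite inE sS orbT.
Qed.

Lemma in_colorsE z : (z \in in_colors A abc) =
  ((pcol A z).1 \in abc) && ((pcol A z).2 \in abc).
Proof. by rewrite inE. Qed.

(** * Extending invariant functions from color points to whole bubbles *)

Section BubbleExtension.

Variable u : vp -> 'F_2.
Hypothesis uA : constant_on u (trace (chords G) X).
Hypothesis uB : constant_on u (trace (preedges G) X).
Hypothesis uC : constant_on u (trace strand_blocks X).

Let traced (P : {set {set vp}}) B x y : constant_on u (trace P X) ->
  B \in P -> x \in B -> y \in B -> x \in X -> y \in X -> u x = u y.
Proof.
move=> uP BP xB yB xX yX; apply: (uP (B :&: X)); [|exact/setIP|exact/setIP].
by apply/traceP; exists B; split=> //; apply/pred0Pn; exists x; apply/andP.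
Qed.

(* An external point gets the value of the attached point of its strand. *)
Definition bubble_extension (z : vp + (ep + vp)) : 'F_2 :=
  match z with
  | inl x | inr (inr x) => u x
  | inr (inl q) =>
    if phi G q is Some x then u x else
    if [pick x | [exists s in strands G, (q \in s) && (x \in att G s)]] is Some x
    then u x else 0%R
  end.

(** The choice made in [bubble_extension] is unambiguous: [q] lies on a single strand, and that
    strand has a single attached point. The default value 0 is thus not taken at such a [q]. *)
Lemma bubble_extension_external h s q q' x : h \in shes G ->
  s \in strands G ::&: h -> q \in s -> q' \in s -> phi G q = None ->
  phi G q' = Some x -> bubble_extension (inr (inl q)) = u x.
Proof.
move=> hS sh qs q's qN q'x; have [q1 [q2 [x1 [Es q1x q2N]]]] := she_strand tG hS sh.
have sS : s \in strands G by move: sh; rewrite inE => /andP[].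
have att_s y : y \in att G s -> y = x1.
  move=> /attP[q0]; rewrite Es => /set2P[->|->]; last by rewrite q2N.
  by rewrite q1x => -[].
rewrite /= qN; have -> : x = x1 by apply: att_s; apply/attP; exists q'.
case: pickP => [y /existsP[s' /and3P[s'S qs' ys']]|/(_ x1)].
  by congr u; apply: att_s; rewrite (partition_inj strands_partition_all sS s'S qs qs').
case/existsP; exists s; rewrite sS qs; apply/attP; exists q1 => //.
by rewrite Es set21.
Qed.

Lemma attached_color_point q x : q \in epoints G -> phi G q = Some x ->
  (ecol G q).1 \in abc -> (ecol G q).2 \in abc -> x \in X.
Proof.
move=> qE qx; rewrite (tame_ecol tG qE qx) in_color_points => -> ->.
by rewrite -(tame_phi_onto tG) !andbT; apply/attP; exists q.
Qed.

Lemma bubble_extension_strand s q q' : s \in strands G -> s \notin cut_strands G C ->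
  q \in s -> q' \in s ->
  (ecol G q).1 \in abc -> (ecol G q).2 \in abc ->
  bubble_extension (inr (inl q)) = bubble_extension (inr (inl q')).
Proof.
move=> sS nc qs q's c1 c2.
have [|Y YE sY] := tame_blocks_edge tG (B := s); first by rewrite inE sS orbT.
have sP : s \in strands G ::&: Y by rewrite inE sS.
have inE' q0 : q0 \in s -> q0 \in epoints G.
  by move=> h; apply: mem_epoints YE (subsetP sY q0 h).
have cq' : ecol G q' = ecol G q by apply: (tame_strands tG sS).
case/setUP: (YE) => [Ye|Ys].
  have YEi : Y \in Ei.
    rewrite inE Ye andbT; apply: contra nc => YC; rewrite inE sS.
    by apply/existsP; exists Y; rewrite YC.
  rewrite /=; have := tame_phi_edges tG Ye (subsetP sY q qs).
  have := tame_phi_edges tG Ye (subsetP sY q' q's).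
  case Ex': (phi G q') => [x'|] // _; case Ex: (phi G q) => [x|] // _.
  apply: (traced (B := att G s) uC).
  - by rewrite inE imset_f //; apply/internal_strandP; exists Y.
  - by apply/attP; exists q.
  - by apply/attP; exists q'.
  - exact: (attached_color_point (inE' q qs) Ex c1 c2).
  - by apply: (attached_color_point (inE' q' q's) Ex'); rewrite cq'.
have [q1 [q2 [x [Es q1x q2N]]]] := she_strand tG Ys sP.
have q1s : q1 \in s by rewrite Es set21.
have q2s : q2 \in s by rewrite Es set22.
have E2 := bubble_extension_external Ys sP q2s q1s q2N q1x.
have E1 : bubble_extension (inr (inl q1)) = u x by rewrite /= q1x.
by move: qs q's; rewrite Es => /set2P[->|->] /set2P[->|->]; rewrite ?E1 ?E2.
Qed.

(** If [B] is attached, its image is a pre-edge and [uB] applies. Otherwise all of [B] is external;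
    the strands carry its points, with their colors, to the attached end [B0] of the half-edge,
    whose image is again a pre-edge. *)
Lemma bubble_extension_end B q q' : B \in ends G ->
  q \in B -> q' \in B ->
  (ecol G q).1 \in abc -> (ecol G q).2 \in abc ->
  (ecol G q').1 \in abc -> (ecol G q').2 \in abc ->
  bubble_extension (inr (inl q)) = bubble_extension (inr (inl q')).
Proof.
move=> BE qB q'B c1 c2 c1' c2'.
have [|Y YE BY] := tame_blocks_edge tG (B := B); first by rewrite inE BE.
have inE' q0 : q0 \in Y -> q0 \in epoints G by apply: mem_epoints.
have [qY q'Y] := (subsetP BY q qB, subsetP BY q' q'B).
have same B' q0 q0' x x' : att G B' \in preedges G -> q0 \in B' -> q0' \in B' ->
    phi G q0 = Some x -> phi G q0' = Some x' -> x \in X -> x' \in X -> u x = u x'.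
  move=> BP q0B q0'B qx q'x' xX x'X.
  by apply: (traced uB BP _ _ xX x'X); apply/attP; [exists q0|exists q0'].
have [/forall_inP attB|] := boolP [forall q0 in B, isSome (phi G q0)].
  have := attB q qB; have := attB q' q'B; rewrite /=.
  case Ex': (phi G q') => [x'|] // _; case Ex: (phi G q) => [x|] // _.
  apply: (same _ _ _ _ _ (tame_phi_ends tG BE attB) qB q'B Ex Ex').
    exact: (attached_color_point (inE' q qY) Ex c1 c2).
  exact: (attached_color_point (inE' q' q'Y) Ex' c1' c2').
case/forall_inPn => q0 q0B; case Ex0: (phi G q0) => [//|] _.
have q0Y := subsetP BY q0 q0B.
case/setUP: (YE) => [Ye|Ys].
  by have := tame_phi_edges tG Ye q0Y; rewrite Ex0.
have [B0 B0Y hB0] := tame_phi_shes tG Ys.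
have BP : B \in ends G ::&: Y by rewrite inE BE.
have nB q1 : q1 \in B -> phi G q1 = None.
  move=> q1B; have := hB0 q1 (subsetP BY q1 q1B); case: (phi G q1) => // x /esym h.
  have E := partition_inj (ends_partition tG YE) BP B0Y q1B h.
  by have := hB0 q0 q0Y; rewrite -E q0B Ex0.
have partner q1 : q1 \in B -> (ecol G q1).1 \in abc -> (ecol G q1).2 \in abc ->
    exists q2 x, [/\ q2 \in B0, phi G q2 = Some x, x \in X &
      bubble_extension (inr (inl q1)) = u x].
  move=> q1B d1 d2; have q1Y := subsetP BY q1 q1B.
  have [s sY q1s] := partition_mem (strands_partition tG YE) q1Y.
  have [q2 [q3 [x [Es q2x q3N]]]] := she_strand tG Ys sY.
  have q2s : q2 \in s by rewrite Es set21.
  have q2Y := subsetP (partition_sub (strands_partition tG YE) sY) q2 q2s.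
  exists q2, x; split=> //.
  - by rewrite -hB0 // q2x.
  - have sS : s \in strands G by move: sY; rewrite inE => /andP[].
    by apply: (attached_color_point (inE' q2 q2Y) q2x);
      rewrite (tame_strands tG sS q2s q1s).
  - exact: (bubble_extension_external Ys sY q1s q2s (nB q1 q1B) q2x).
have [p [x [pB px xX ->]]] := partner q qB c1 c2.
have [p' [x' [p'B p'x' x'X ->]]] := partner q' q'B c1' c2'.
apply: (same _ _ _ _ _ (tame_phi_ends tG _ _) pB p'B px p'x' xX x'X).
  by move: B0Y; rewrite inE => /andP[].
move=> q1 q1B; rewrite hB0 //.
exact: subsetP (partition_sub (ends_partition tG YE) B0Y) q1 q1B.
Qed.

(** Bubbles are connected through edge points and external points too, while [u] is given on vertex
    points only. With this invariance, [comps_const] makes [u] constant on the color points of one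
    bubble. *)
Lemma bubble_extension_constant :
  {in points A :&: in_colors A abc &, forall z z',
     bubble_adj A z z' -> bubble_extension z = bubble_extension z'}.
Proof.
move=> z z' /setIP[zA]; rewrite in_colorsE => /andP[z1 z2] /setIP[z'A].
rewrite in_colorsE => /andP[z'1 z'2]; rewrite /bubble_adj.
case: z z' zA z1 z2 z'A z'1 z'2 => [x|w] [y|w'] /= zA z1 z2 z'A z'1 z'2.
- rewrite !vpoint_points in zA z'A.
  have xX : x \in X by rewrite in_color_points zA z1.
  have yX : y \in X by rewrite in_color_points z'A z'1.
  case/orP => /same_blockP[B BP /andP[xB yB]].
    exact: traced uA BP xB yB xX yX.
  exact: traced uB BP xB yB xX yX.
- by case: w' {z'A z'1 z'2} => [q|y] //; rewrite orbF => /eqP ->.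
- by case: w {zA z1 z2} => [q|x] //; rewrite orbF => /eqP ->.
rewrite !epoint_points in zA z'A.
(* There are four sorts of blocks: uncut strands, strands of the new half-edges, old ends, and new
   external ends, which are copies of pre-edges. *)
case/orP => /same_blockP[B + /andP[]]; case/setUP => /imsetP.
- case=> s /setDP[sS nc] ->.
  case: w w' zA z1 z2 z'A z'1 z'2 => [q|x] [q'|x'] zA z1 z2 z'A z'1 z'2;
    rewrite ?in_lift_eF ?in_lift_e // => qs q's.
  exact: (bubble_extension_strand sS nc qs q's z1 z2).
- case=> -[q x]; rewrite inE /= => /andP[_ /eqP qx] -> /set2P[]-> /set2P[]->;
    by rewrite /= ?qx.
- case=> B' BE ->.
  case: w w' zA z1 z2 z'A z'1 z'2 => [q|x] [q'|x'] zA z1 z2 z'A z'1 z'2;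
    rewrite ?in_lift_eF ?in_lift_e // => qs q's.
  exact: (bubble_extension_end BE qs q's z1 z2 z'1 z'2).
case=> B' /(cut_end_preedge tG CE) BP ->.
case: w w' zA z1 z2 z'A z'1 z'2 => [q|x] [q'|x'] zA z1 z2 z'A z'1 z'2;
  rewrite ?in_lift_vF ?in_lift_v // => xB x'B.
have BV := subsetP (partition_sub (tame_preedges tG) BP).
by apply: (traced uB BP xB x'B); rewrite in_color_points BV // ?z1 ?z'1.
Qed.

End BubbleExtension.

(** In [traced_partition_bound] the edge blocks stand on the left and the pre-edges on the right. By
    [preedge_trace_bound] their difference is at most the number of uncut edges meeting the color
    points. *)
Lemma color_triple_bound :
  #|[set v in vertices G | ~~ [disjoint v & X]]| +
  #|[set K in closed_faces A | ~~ [disjoint face_trace K & X]]| <=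
  #|[set e in Ei | ~~ [disjoint att G e & X]]| + 2 * #|bubbles A abc|.
Proof.
pose c (x : vp) := pblock (bubbles A abc) (inl x).
have inlP x : x \in X -> inl x \in points A :&: in_colors A abc.
  by rewrite in_color_points -andbA inE vpoint_points inE /= => /andP[-> ->].
have pb : partition (bubbles A abc) (points A :&: in_colors A abc).
  exact: comps_partition.
have cov x : x \in X -> inl x \in cover (bubbles A abc).
  by move/inlP; case/and3P: pb => /eqP ->.
have cX : #|c @: X| <= #|bubbles A abc|.
  apply/subset_leq_card/subsetP => _ /imsetP[x xX ->].
  exact/pblock_mem/cov.
have tV : trivIset (vertices G) by case/and3P: (tame_vertices tG).
have := traced_partition_bound (X := X) (c := c) (tame_chords tG) (tame_preedges tG)
  strand_blocks_partition color_points_sub chord_trace preedge_trace strand_block_trace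
  tV (saturated_vertices (subsetUr _ _)) (saturated_vertices (subsetUl _ _))
  face_traces_trivIset saturated_chords_faces saturated_strands_faces
  edge_blocks_trivIset saturated_preedges_edge_blocks saturated_strand_edge_blocks.
have -> : #|trace (vertices G) X| = #|[set v in vertices G | ~~ [disjoint v & X]]|.
  exact: card_trace.
have -> : #|trace face_traces X| =
    #|[set K in closed_faces A | ~~ [disjoint face_trace K & X]]|.
  rewrite card_trace ?face_traces_trivIset //.
  rewrite -[RHS](card_in_imset (f := @face_trace vp ep)); last first.
    by move=> K K' /setIdP[KF _] /setIdP[K'F _]; apply: (face_trace_inj tG CE KF K'F).
  congr #|pred_of_set _|; apply/setP => S; apply/setIdP/imsetP.
    by case=> /imsetP[K KF ->] KX; exists K => //; apply/setIdP.
  by case=> K /setIdP[KF KX] ->; split=> //; apply: imset_f.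
move=> /(_ _)H; have := preedge_trace_bound.
(* The classes of [c] are the bubbles, so it remains to see that a function invariant under the
   three traces is constant on the color points of each bubble. *)
suff : forall u : vp -> 'F_2, (forall x, x \notin X -> u x = 0%R) ->
     constant_on u (trace (chords G) X) -> constant_on u (trace (preedges G) X) ->
     constant_on u (trace strand_blocks X) ->
     {in X &, forall x y, c x = c y -> u x = u y} by move/H; lia.
move=> u _ uA uB uC x y xX yX cxy.
have xc : inl x \in c x by rewrite mem_pblock cov.
have yc : inl y \in c x by rewrite cxy mem_pblock cov.
exact: comps_const (bubble_extension_constant uA uB uC) (pblock_mem (cov x xX)) xc yc.
Qed.

End ColorTriple.

(** * Counting and exponents *)

(** Each component of [r] lies in a component of [r']; the resulting map [h], computed from an
    arbitrary point, is onto. *)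
Lemma card_comps_refine (T : finType) (r r' : rel T) (A : {set T}) :
  {in A &, forall x y, r x y -> r' x y} -> #|comps r' A| <= #|comps r A|.
Proof.
move=> rr'; have p := comps_partition r A; have p' := comps_partition r' A.
pose h (K : {set T}) := if [pick x in K] is Some x then pblock (comps r' A) x else set0.
apply: leq_trans (leq_imset_card h _).
apply/subset_leq_card/subsetP => K' K'c; have [x xK'] := partition_nonempty p' K'c.
have [K Kc xK] := partition_mem p (subsetP (partition_sub p' K'c) x xK').
apply/imsetP; exists K => //.
rewrite /h; case: pickP => [y yK|/(_ x)]; last by rewrite xK.
have t' : trivIset (comps r' A) by case/and3P: p'.
have same : pblock (comps r' A) x = pblock (comps r' A) y.
  apply: (comps_const _ Kc xK yK) => a b aA bA rab.
  have [L Lc aL] := partition_mem p' aA.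
  have bL : b \in L by apply: (comps_step Lc aL bA); rewrite rr'.
  by rewrite (def_pblock t' Lc aL) (def_pblock t' Lc bL).
by rewrite -same (def_pblock t' K'c xK').
Qed.

Lemma sum_card_exchange (S T : finType) (A : {set S}) (P : pred T) (R : S -> T -> bool) :
  \sum_(t | P t) #|[set a in A | R a t]| = \sum_(a in A) #|[set t | P t & R a t]|.
Proof.
rewrite (eq_bigr (fun t => \sum_(a in A) R a t)) => [|t _]; last first.
  by rewrite -sum1_card -big_mkcondr /=; apply: eq_bigl => a; rewrite inE.
rewrite exchange_big /=; apply: eq_bigr => a _.
by rewrite -sum1_card -big_mkcondr /=; apply: eq_bigl => t; rewrite inE.
Qed.

(** A triple of four colors is the complement of one color, and it contains [s] exactly when the
    omitted color is outside [s]. *)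
Lemma card_color_triples (s : {set 'I_4}) :
  #|[set abc : {set 'I_4} | #|abc| == 3 & s \subset abc]| = 4 - #|s|.
Proof.
have -> : [set abc : {set 'I_4} | #|abc| == 3 & s \subset abc] =
    [set [set~ d] | d in ~: s].
  apply/setP => abc; rewrite inE; apply/andP/imsetP => [[abc3 sabc]|[d ds ->]].
    have /cards1P[d Ed] : #|~: abc| == 1.
      by have := cardsC abc; rewrite card_ord (eqP abc3); case: #|~: abc| => [|[|]].
    exists d; last by rewrite -Ed setCK.
    by rewrite inE; apply: contraL (set11 d) => /(subsetP sabc); rewrite -Ed inE negbK.
  rewrite cardsC1 card_ord; split=> //; apply/subsetP => x xs.
  by rewrite !inE; apply: contraTneq xs => ->; rewrite inE in ds.
rewrite card_imset; last by move=> x y /setC_inj/set1_inj.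
by have := cardsC s; rewrite card_ord; lia.
Qed.

Section Counting.

Variables (vp ep : finType) (G : colored_graph 3 vp ep).
Variable C : {set {set ep}}.
Hypotheses (tG : tame G) (CE : C \subset edges G).
Let A := ccut G C.
Let triple (abc : {set 'I_4}) := #|abc| == 3.

(** A single pre-edge suffices: if its color is a, each of the three triples containing a has
    another color j, and the pre-edge has a point of color (a, j). *)
Lemma vertex_color_triples v : v \in vertices G ->
  3 <= #|[set abc | triple abc & ~~ [disjoint v & color_points G abc]]|.
Proof.
move=> vV; have [x xv] := partition_nonempty (tame_vertices tG) vV.
have xV := subsetP (partition_sub (tame_vertices tG) vV) x xv.
have [P PP xP] := partition_mem (tame_preedges tG) xV.
have := card_color_triples [set (vcol G x).1]; rewrite cards1 => c3.
apply: leq_trans (eq_leq (esym c3)) _.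
apply/subset_leq_card/subsetP => abc; rewrite !inE sub1set => /andP[abc3 aabc].
rewrite /triple abc3; have := cardsD1 (vcol G x).1 abc.
rewrite aabc (eqP abc3) add1n => -[c2].
have /card_gt0P[j /setD1P[nj jabc]] : 0 < #|abc :\ (vcol G x).1| by rewrite -c2.
have : j \in [set~ (vcol G x).1] by rewrite !inE.
rewrite -(preedge_second_colors tG PP xP) => /imsetP[y yP Ej].
apply/pred0Pn; exists y; apply/andP; split.
  by apply: (subsetP (in_vertex tG vV _ xP xv)) yP; rewrite inE PP.
rewrite /= in_color_points -Ej jabc (tame_preedge_color1 tG PP yP xP) aabc.
by rewrite (subsetP (partition_sub (tame_preedges tG) PP) y yP).
Qed.

Lemma edge_color_triples e : e \in edges G ->
  #|[set abc | triple abc & ~~ [disjoint att G e & color_points G abc]]| <= 3.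
Proof.
move=> eE; have [->|/set0Pn[abc0]] :=
  eqVneq [set abc | triple abc & ~~ [disjoint att G e & color_points G abc]] set0.
  by rewrite cards0.
rewrite inE => /andP[_ /pred0Pn[x /andP[/attP[q qe qx] _]]].
have := card_color_triples [set (ecol G q).1]; rewrite cards1 => c3.
apply: leq_trans (eq_leq c3).
apply/subset_leq_card/subsetP => abc; rewrite !inE sub1set.
case/andP => abc3 /pred0Pn[y /andP[/attP[q' q'e q'y]]].
rewrite /= [#|abc| == 3]abc3 in_color_points -andbA => /and3P[_ y1 _].
rewrite (tame_edge_color tG (mem_edge eE) qe q'e).
by rewrite (tame_ecol tG (mem_epoints (mem_edge eE) q'e) q'y).
Qed.

Lemma face_color_triples K : K \in closed_faces A ->
  2 <= #|[set abc | triple abc & ~~ [disjoint face_trace K & color_points G abc]]|.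
Proof.
move=> KF; have [x xV xK] := closed_face_vpoint tG CE KF.
have := card_color_triples (color_pair G x).
rewrite cards2 (tame_color_neq tG xV) => c2.
apply: leq_trans (eq_leq (esym c2)) _.
apply/subset_leq_card/subsetP => abc; rewrite !inE => /andP[abc3 sub].
rewrite /triple abc3 /=.
by apply/pred0Pn; exists x; rewrite /= !inE xK xV.
Qed.

Lemma sum_bubbles :
  \sum_(abc : {set 'I_4} | triple abc) #|bubbles A abc| = nBint A + nBext A.
Proof.
rewrite /nBint /nBext -big_split; apply: eq_bigr => abc _ /=.
rewrite -(cardsID [set b : {set vp + (ep + vp)} | [disjoint b & external A]]).
by congr addn; apply: eq_card => b; rewrite !inE // andbC.
Qed.

Lemma vertex_face_bound :
  3 * #|vertices G| + 2 * #|closed_faces A| <=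
    3 * #|edges G :\: C| + 2 * (nBint A + nBext A).
Proof.
rewrite -sum_bubbles big_distrr /=.
have : \sum_(abc : {set 'I_4} | triple abc)
    (#|[set v in vertices G | ~~ [disjoint v & color_points G abc]]| +
     #|[set K in closed_faces A | ~~ [disjoint face_trace K & color_points G abc]]|) <=
  \sum_(abc : {set 'I_4} | triple abc)
    (#|[set e in edges G :\: C | ~~ [disjoint att G e & color_points G abc]]| +
     2 * #|bubbles A abc|).
  by apply: leq_sum => abc /eqP abc3; apply: color_triple_bound.
rewrite !big_split /= !sum_card_exchange.
have : 3 * #|vertices G| <= \sum_(v in vertices G)
    #|[set abc | triple abc & ~~ [disjoint v & color_points G abc]]|.
  by rewrite mulnC -sum_nat_const; apply: leq_sum => v; apply: vertex_color_triples.
have : 2 * #|closed_faces A| <= \sum_(K in closed_faces A)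
    #|[set abc | triple abc & ~~ [disjoint face_trace K & color_points G abc]]|.
  by rewrite mulnC -sum_nat_const; apply: leq_sum => K; apply: face_color_triples.
have : \sum_(e in edges G :\: C)
    #|[set abc | triple abc & ~~ [disjoint att G e & color_points G abc]]| <=
    3 * #|edges G :\: C|.
  rewrite mulnC -sum_nat_const; apply: leq_sum => e /setDP[eE _].
  exact: edge_color_triples.
move=> h3 h2 h1 h; apply: leq_trans (leq_add h1 h2) _; apply: leq_trans h _.
by rewrite leq_add2r.
Qed.

Lemma nE_cut : nE A = #|edges G :\: C|.
Proof.
rewrite /nE card_imset //; apply: imset_inj; exact: inl_inj.
Qed.

Lemma att_lift X : att A (lift_e vp X) = att G X.
Proof.
apply/setP => x; apply/attP/attP => [[[q|y]]|[q qX qx]].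
- by rewrite in_lift_e => qX qx; exists q.
- by rewrite in_lift_eF.
- by exists (inl q); rewrite ?in_lift_e.
Qed.

Lemma underlying_adj_cutP v v' :
  reflect (exists2 e, e \in edges G :\: C &
             (v \in end_vertices G e) && (v' \in end_vertices G e))
          (underlying_adj A v v').
Proof.
have E X : end_vertices A (lift_e vp X) = end_vertices G X.
  by apply/setP => w; rewrite !inE att_lift.
apply: (iffP existsP) => [[_ /andP[/imsetP[X XE ->]]]|[e eE h]].
  by rewrite E; exists X.
by exists (lift_e vp e); rewrite E h andbT; apply: imset_f.
Qed.

(** Cutting keeps the vertices, so the exponent of x - 1 is the difference [nk A - nk G]. *)
Lemma nk_cut : nk G <= nk A.
Proof.
rewrite leq_add2r; apply: card_comps_refine => v v' _ _.
case/underlying_adj_cutP => e /setDP[eE _] h.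
by apply/existsP; exists e; rewrite eE.
Qed.

(** The map [h] sends each of the two ends of [e] to the vertex containing its pre-edge, and its
    image covers the end vertices. A loop yields a single vertex. *)
Lemma card_end_vertices e : e \in edges G -> #|end_vertices G e| <= 2.
Proof.
move=> eE; pose h B :=
  if [pick w in vertices G | att G B \subset w] is Some w then w else set0.
have /and5P[_ _ /and3P[pB /eqP cB _] _ _] := tame_edges tG (mem_edge eE).
apply: leq_trans (eq_leq cB); apply: leq_trans (leq_imset_card h _).
apply/subset_leq_card/subsetP => w.
rewrite inE => /andP[wV /pred0Pn[x /andP[xw /attP[q qe qx]]]].
have [B BB qB] := partition_mem pB qe; apply/imsetP; exists B => //.
have [BE Be] : B \in ends G /\ B \subset e by apply/andP; move: BB; rewrite inE.
have xB : x \in att G B by apply/attP; exists q.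
have PB : att G B \in preedges G := att_end_preedge tG eE BE Be.
rewrite /h; case: pickP => [w' /andP[w'V Bw']|/(_ w)].
  exact: (partition_inj (tame_vertices tG) wV w'V xw (subsetP Bw' x xB)).
by rewrite wV (in_vertex tG wV _ xB xw) // inE PB.
Qed.

(** This is the sign of the exponent of y - 1. The forest bound is applied to the sets of end
    vertices; parallel edges give the same set, which can only lower the number of sets. Trivial
    circles count equally as vertices and as components. *)
Lemma nV_le_cut : nV A <= nE A + nk A.
Proof.
rewrite nE_cut /nV /nk addnA leq_add2r addnC.
pose c v := pblock (comps (underlying_adj A) (vertices G)) v.
have pc := comps_partition (underlying_adj A) (vertices G).
have cov v : v \in vertices G -> v \in cover (comps (underlying_adj A) (vertices G)).
  by case/and3P: pc => /eqP ->.
pose E := [set end_vertices G e | e in edges G :\: C].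
apply: leq_trans (forest_bound (E := E) (c := c) _ _) _.
- by move=> _ /imsetP[e /setDP[eE _] ->]; apply: card_end_vertices.
- move=> u hu v w vV wV cvw.
  have vc : v \in c v by rewrite mem_pblock cov.
  have wc : w \in c v by rewrite cvw mem_pblock cov.
  apply: comps_const _ (pblock_mem (cov v vV)) vc wc => a b _ _.
  case/underlying_adj_cutP => e eE /andP[ae be].
  by apply: (hu (end_vertices G e)) => //; apply: imset_f.
apply: leq_add; last exact: leq_imset_card.
apply/subset_leq_card/subsetP => _ /imsetP[v vV ->]; exact/pblock_mem/cov.
Qed.

End Counting.

(** * Elements of the fraction field that come from the ring *)

Section Integrality.

Local Open Scope ring_scope.

Variable R : idomainType.
Implicit Types z : {fraction R}.

Definition in_ring z : Prop := exists p : R, z = tofrac p.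

Lemma in_ringM z z' : in_ring z -> in_ring z' -> in_ring (z * z').
Proof. by move=> [p ->] [p' ->]; exists (p * p'); rewrite rmorphM. Qed.

Lemma in_ringX z n : in_ring z -> in_ring (z ^+ n).
Proof. by move=> [p ->]; exists (p ^+ n); rewrite rmorphXn. Qed.

(** A nonnegative exponent takes no inverse; this reduces polynomiality to the signs of the three
    integer exponents. *)
Lemma in_ringXz z (k : int) : (0 <= k)%R -> in_ring z -> in_ring (z ^ k).
Proof. by case: k => // n _; apply: in_ringX. Qed.

Lemma in_ring_sum (I : finType) (P : pred I) (f : I -> {fraction R}) :
  (forall i, P i -> in_ring (f i)) -> in_ring (\sum_(i | P i) f i).
Proof.
move=> h; apply: (big_ind in_ring) => //; first by exists 0; rewrite rmorph0.
by move=> _ _ [p ->] [p' ->]; exists (p + p'); rewrite rmorphD.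
Qed.

End Integrality.

Theorem proposition4p31 (vp ep : finType) (G : colored_graph 3 vp ep) :
  w_colored G ->
  exists p : {mpoly int[7]},
    T_poly G (indet (inord 0)) (indet (inord 1)) (indet (inord 2))
             (indet (inord 3)) (indet (inord 4)) (indet (inord 5))
             (indet (inord 6)) = tofrac p.
Proof.
move=> /w_colored_tame tG.
have indetP i : in_ring (indet i) by exists 'X_i.
have indet1P i : in_ring (indet i - 1)%R by exists ('X_i - 1)%R; rewrite rmorphB rmorph1.
apply: in_ring_sum => C CE; cbv zeta.
have hk := nk_cut G C; have hn := nV_le_cut C tG.
have hz := vertex_face_bound tG CE.
repeat apply: in_ringM; try exact: in_ringX;
  apply: in_ringXz => //; rewrite /rk /nullity.
- by rewrite -[nV (ccut G C)]/(nV G); lia.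
- lia.
(* Once the trivial circles cancel, the exponent is five times the number of remaining components
   plus a difference that [hz] makes nonnegative. *)
move: hz; rewrite -(nE_cut G C) /nk /nV /nFint -[vertices (ccut G C)]/(vertices G).
lia.
Qed.
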